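(* Let $n\ge1$ be an integer, $x\in\mathbb{R}$, and let $a=(a^{-1},a^0,\dots,a^n)\in \mathbb{R}^{n+2}$ where $a^{-1} \le 0$ and $a^1 \neq 0$. Suppose $H_m(a) > 0$ where $m$ is the integer part of $\tfrac 12 (n+1)$. Then the general solution of Problem $\partial CF\mathcal{P}$ with data $x$, $a$ is $$ f(z)= \frac{a^{-1}}{z-x}+ \frac {A(z) h(z) + B(z)}{C(z) h(z) + D(z)} $$ where $A, B, C, D$ are real polynomials of degree at most $m$ satisfying, for some $K>0$, $$ (AD-BC)(z) = K (z-x)^{2m} $$ and given by $$ \begin{bmatrix} A(z) & B(z) \\ C(z) & D(z) \end{bmatrix} = A_1(z) A_2(z) \dots A_{m}(z),\qquad A_k(z) = \begin{bmatrix} s_k t_k(z-x) & -t_k(z-x)-s_k \\ t_k(z-x) & -1 \end{bmatrix}, $$ the quantities $s_k,t_k$ are as defined in the context, and: if $n$ is even then $h$ is any function in $\mathcal{P}$ that is analytic at $x$ and satisfies $h(x) = s_{m+1}$; if $n$ is odd then $h$ is any function in $\mathcal{P}$ that is analytic at $x$.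
   Context: Superscripts on $a$ (and on $a(j)$) are indices, not powers; powers are written with parentheses. $\Pi=\{z\in\mathbb{C}:\operatorname{Im} z>0\}$. The Pick class $\mathcal{P}$ is the set of analytic functions $f$ on $\Pi$ with $\operatorname{Im} f\ge 0$ on $\Pi$. For $x\in\mathbb{R}$, $f\in\mathcal{P}$ is analytic at $x$ if $f$ extends to a function analytic in a neighbourhood of $x$; it is meromorphic at $x$ if it extends to a function analytic in a deleted neighbourhood of $x$ with at most a pole at $x$. Problem $\partial CF\mathcal{P}$: given $x\in\mathbb{R}$ and $a^{-1},a^0,\dots,a^n\in\mathbb{C}$, find $f\in\mathcal{P}$, meromorphic at $x$, such that $L_k(f,x)=a^k$ for $k=-1,0,1,\dots,n$, where $L_k(f,x)$ is the $k$th Laurent coefficient of $f$ at $x$. Such an $f$ is called a solution. ''The general solution is ...'' means that the solutions are exactly the functions of the given form. For a positive integer $m$ with $2m-1\le n$, $H_m(a)=[a^{i+j-1}]_{i,j=1}^m$; $H_m(a)>0$ means positive definite. The quantities $s_k,t_k$: define $a^i(j)$ for $j=1,\dots,m$, $0\le i\le n-2(j-1)$, inductively by $a^i(1)=a^i$ and $$ a^1(j) \begin{bmatrix} a^1(j) & 0 & \cdots & 0 \\ a^2(j) & a^1(j) & \cdots & 0 \\ \vdots & \vdots & \ddots & \vdots \\ a^{n-2j+1}(j) & a^{n-2j}(j) & \cdots & a^1(j) \end{bmatrix} \begin{bmatrix} a^0(j+1) \\ a^1(j+1) \\ \vdots \\ a^{n-2j}(j+1) \end{bmatrix} = \begin{bmatrix}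 a^2(j) \\ a^3(j) \\ \vdots \\ a^{n -2(j-1)}(j) \end{bmatrix} $$ (under the hypothesis $H_m(a)>0$ all $a^1(j)$, $1\le j\le m$, are positive). Then $s_j=a^0(j)$, $t_j=a^1(j)$ for $j=1,\dots,m$, and, if $n$ is even, $s_{m+1}=a^2(m)/(a^1(m))^2$. *)

(* Defs.v *)
(* MathComp + MathComp-Analysis; the complex field is R[i] for R : realType. *)
From HB Require Import structures.
From mathcomp Require Import all_boot all_order all_algebra.
From mathcomp Require Import classical_sets boolp topology normedtype sequences.
From mathcomp Require Import reals complex.

Set Implicit Arguments.
Unset Strict Implicit.
Unset Printing Implicit Defensive.

Import Order.TTheory GRing.Theory Num.Theory numFieldNormedType.Exports.

Local Open Scope classical_set_scope.
Local Open Scope ring_scope.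

Section Analytic.
Variable K : numFieldType.
Implicit Types (f F : K -> K) (D : set K) (L : int -> K).

Definition analytic_at f (w : K) : Prop :=
  exists c : nat -> K,
    \forall z \near w, series (fun k => c k * (z - w) ^+ k) @ \oo --> f z.

(* F has a Laurent expansion \sum_(k >= - N) L k (z - w)^k in a punctured
   neighbourhood of w, i.e. at most a pole at w. *)
Definition laurent_expansion F (w : K) L : Prop :=
  exists N : nat,
    (forall k : int, k < - N%:Z -> L k = 0) /\
    \forall z \near w^',
      series (fun k : nat => L (k%:Z - N%:Z) * (z - w) ^ (k%:Z - N%:Z)) @ \oo
        --> F z.

(* In the next two definitions f matters only on D, and w need not be in D
   (below, D is the upper half-plane and w a real point). *)
Definition analytic_extension D f (w : K) F : Prop :=
  (\forall z \near w, D z -> F z = f z) /\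
  (\forall z \near w, analytic_at F z).

Definition has_laurent_coefs D f (w : K) L : Prop :=
  exists F,
    [/\ \forall z \near w, D z -> F z = f z,
        \forall z \near w^', analytic_at F z
      & laurent_expansion F w L].

End Analytic.

Section Pick.
Variable R : realType.
Implicit Types (f h : R[i] -> R[i]) (x : R) (n : nat).

Definition upper_half_plane : set R[i] := [set z | 0 < complex.Im z].

(* Values of f outside the upper half-plane are irrelevant. *)
Definition pick_class f : Prop :=
  forall z, upper_half_plane z -> analytic_at f z /\ 0 <= complex.Im (f z).

(* Problem \partial CFP; only a (-1), a 0, ..., a n are used. *)
Definition bCFP_solution n x (a : int -> R[i]) f : Prop :=
  pick_class f /\
  exists L : int -> R[i],
    has_laurent_coefs upper_half_plane f x%:C%C L /\
    forall k : int, -1 <= k <= n%:Z -> L k = a k.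

(* h belongs to the Pick class, is analytic at x, and its value there (that of
   its analytic extension) satisfies P. *)
Definition pick_analytic_at x h (P : R[i] -> Prop) : Prop :=
  pick_class h /\
  exists H, analytic_extension upper_half_plane h x%:C%C H /\ P (H x%:C%C).

Definition evalC (p : {poly R}) (z : R[i]) : R[i] :=
  (map_poly (real_complex R) p).[z].

End Pick.

Section Algebra.
Variable R : realType.
Implicit Types (a : int -> R) (b : nat -> R) (n m : nat).

(* Indices are shifted: i + j + 1 = (i + 1) + (j + 1) - 1. *)
Definition hankel m a : 'M[R]_m := \matrix_(i < m, j < m) a (i + j + 1)%N%:Z.

Definition posdefmx m (H : 'M[R]_m) : Prop :=
  H^T = H /\ forall v : 'cV[R]_m, v != 0 -> 0 < (v^T *m H *m v) 0 0.

Definition toeplitz N b : 'M[R]_N :=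
  \matrix_(i < N, j < N) if (j <= i)%N then b (i - j).+1 else 0.

(* The solution c^0, ..., c^(N-1) of
     b^1 * toeplitz N b * (c^0, ..., c^(N-1)) = (b^2, ..., b^(N+1)),
   extended by 0; see reduce_dataP. *)
Definition reduce_data N b : nat -> R := fun i =>
  if insub i is Some k then
    (invmx (b 1%N *: toeplitz N b) *m \col_(l < N) b l.+2) k 0
  else 0.

Lemma reduce_dataP N b : b 1%N != 0 ->
  b 1%N *: (toeplitz N b *m \col_(l < N) reduce_data N b l)
  = \col_(l < N) b l.+2.
Proof.
move=> b1.
have trigT : is_trig_mx (toeplitz N b).
  by apply/is_trig_mxP => i j ij; rewrite mxE leqNgt ij.
have unitT : b 1%N *: toeplitz N b \in unitmx.
  rewrite unitmxE detZ det_trig // unitrM unitrX ?unitfE //=.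
  by apply/prodf_neq0 => i _; rewrite mxE leqnn subnn.
have -> : \col_(l < N) reduce_data N b l
        = invmx (b 1%N *: toeplitz N b) *m \col_(l < N) b l.+2.
  by apply/colP => k; rewrite mxE /reduce_data valK.
by rewrite scalemxAl mulKVmx.
Qed.

(* iter_data n a j i is a^i(j), for j >= 1 and 0 <= i <= n - 2 (j - 1);
   other entries are meaningless.  The system giving a(j+1) from a(j) has
   size n - 2 j + 1. *)
Fixpoint iter_data n a (j : nat) : nat -> R :=
  match j with
  | j'.+1 => if j' == 0%N then fun i => a i%:Z
             else reduce_data (n.+1 - 2 * j') (iter_data n a j')
  | 0 => fun _ => 0
  end.

Definition s_ n a j : R := iter_data n a j 0%N.

Definition t_ n a j : R := iter_data n a j 1%N.

(* s_(m+1), for n = 2 m. *)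
Definition s_last n a m : R := iter_data n a m 2%N / (iter_data n a m 1%N) ^+ 2.

Definition mx2 (T : Type) (p q r s : T) : 'M[T]_2 :=
  \matrix_(i, j) if i == 0 then (if j == 0 then p else q)
                 else (if j == 0 then r else s).

Definition A_ n (x : R) a k : 'M[{poly R}]_2 :=
  let w : {poly R} := 'X - x%:P in
  let s := s_ n a k in
  let t := t_ n a k in
  mx2 ((s * t) *: w) (- (t *: w) - s%:P)
      (t *: w)       (- 1).

Definition A_prod n (x : R) a m : 'M[{poly R}]_2 :=
  \prod_(1 <= k < m.+1) A_ n x a k.

End Algebra.

(* Main.v *)
Require Import Defs.
From HB Require Import structures.
From mathcomp Require Import all_boot all_order all_algebra.
From mathcomp Require Import classical_sets boolp topology normedtype sequences.
From mathcomp Require Import reals complex.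
From mathcomp Require Import derive ring lra zify.
Set Implicit Arguments.
Unset Strict Implicit.
Unset Printing Implicit Defensive.
Import Order.TTheory GRing.Theory Num.Theory numFieldNormedType.Exports.
Local Open Scope ring_scope.

(** Subtracting the pole and applying Julia's reduction m times turns the
problem into one without data, or with a single prescribed value.

If [f] is a Pick function, analytic at [x] with value [s] real and derivative
[t > 0], then [h = 1 / (t (z - x)) - 1 / (f - s)] is a Pick function analytic
at [x], and [f = s + t (z - x) / (1 - t (z - x) h)] ([augment]).  Conversely
every Pick [h] analytic at [x] gives such an [f] ([pick_augment],
[boundary_augment]).  The Taylor coefficients of [f] and [h] are tied by
[c (k+2) = t * sum_(i <= k) c (i+1) c' (k-i)], which is the triangular Toeplitz
system of the inductive definition of [a^i(j)].  Each augmentation is the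
linear fractional map of the matrix [A_k], so [m] of them compose to the
product [A_1 ... A_m] ([stage_chain]).

That [h] is in the Pick class is Julia's lemma, obtained from one minimum
principle ([pole_removal]): if [f] is a Pick function, [r >= 0], and
[f + r / (z - x)] has a limit at [x] from the half-plane, then
[f + r / (z - x)] again has nonnegative imaginary part.  With [r = - a (-1)] it
also removes the pole of the original problem.  An imaginary part below a given
negative level could only occur in the interior of a compact rectangle; there, a
minimum is excluded by averaging the function, penalised by a small multiple of
[|z - x|^2], over four points [p + e i^k], since the first and second order
Taylor terms cancel in that average.  Division by [f - s] is legitimate because
the imaginary part of [f] is strictly positive ([pick_positive]).

A Pick function cannot have a pole of order greater than one at [x], as some
direction in the half-plane would make the leading term have negative
imaginary part ([pole_direction]).

The numbers [t_j] are positive because the Hankel matrix of the data factors as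
[T (1/t (+) H') T^T], with [T] an invertible triangular Toeplitz matrix and [H']
the Hankel matrix of the reduced data ([hankel_seq_descent]).

Analyticity is handled through remainder estimates: [taylor f w c] bounds every
remainder of order [n] by [M (rho |z - w|)^n].  This is equivalent to being the
sum of the power series near [w] ([analytic_atP]), and it is stable under sums,
multiplication by [z - w], division by [z - w] and reciprocals by finite
computations only. *)

(** * The real-valued modulus and limits in the complex field *)

Section Norm.
Variable R : realType.
Local Notation C := R[i].
(** The modulus as an element of [R]: the norm on [R[i]] itself takes
its values in [R[i]], where only real elements are comparable. *)
Definition nrm (z : C) : R := complex.Re `|z|.
Lemma nrmE (z : C) : `|z| = (nrm z)%:C%C.
Proof. by rewrite /nrm normc_def. Qed.
Lemma nrm_ge0 z : 0 <= nrm z.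
Proof. by rewrite -lecR -nrmE normr_ge0. Qed.
Lemma nrmM : {morph nrm : x y / x * y}.
Proof. by move=> x y; apply: complexI; rewrite rmorphM /= -!nrmE normrM. Qed.
Lemma nrmN z : nrm (- z) = nrm z.
Proof. by rewrite /nrm normrN. Qed.
Lemma nrmB x y : nrm (x - y) = nrm (y - x).
Proof. by rewrite -nrmN opprB. Qed.
Lemma nrmV z : nrm z^-1 = (nrm z)^-1.
Proof. by apply: complexI; rewrite -nrmE normfV nrmE fmorphV. Qed.
Lemma nrmX z n : nrm (z ^+ n) = nrm z ^+ n.
Proof. by apply: complexI; rewrite rmorphXn /= -!nrmE normrX. Qed.
Lemma nrmD x y : nrm (x + y) <= nrm x + nrm y.
Proof. by rewrite -lecR rmorphD /= -!nrmE ler_normD. Qed.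
Lemma nrm0 : nrm 0 = 0.
Proof. by rewrite /nrm normr0. Qed.
Lemma nrm_eq0 z : (nrm z == 0) = (z == 0).
Proof. by rewrite -(inj_eq (@complexI R)) -nrmE normr_eq0. Qed.
Lemma nrm_gt0 z : (0 < nrm z) = (z != 0).
Proof. by rewrite lt_neqAle nrm_ge0 andbT eq_sym nrm_eq0. Qed.
Lemma nrmR (r : R) : nrm r%:C%C = `|r|.
Proof. by rewrite /nrm normc_def /= expr0n /= addr0 sqrtr_sqr. Qed.
Lemma nrm_i : nrm ('i%C : C) = 1.
Proof. by rewrite /nrm normc_def /= expr0n expr1n /= add0r sqrtr1. Qed.
Lemma nrm_sqr z : nrm z ^+ 2 = complex.Re z ^+ 2 + complex.Im z ^+ 2.
Proof. by rewrite /nrm normc_def /= sqr_sqrtr // addr_ge0 ?sqr_ge0. Qed.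
Lemma Im_le_nrm z : `|complex.Im z| <= nrm z.
Proof.
rewrite -(ler_pXn2r (n:=2)) ?nnegrE ?nrm_ge0 ?normr_ge0 //.
by rewrite nrm_sqr real_normK ?num_real // lerDr sqr_ge0.
Qed.
Lemma Re_le_nrm z : `|complex.Re z| <= nrm z.
Proof.
rewrite -(ler_pXn2r (n:=2)) ?nnegrE ?nrm_ge0 ?normr_ge0 //.
by rewrite nrm_sqr real_normK ?num_real // lerDl sqr_ge0.
Qed.
Lemma nrm_sum (I : Type) (r : seq I) (P : pred I) (F : I -> C) :
  nrm (\sum_(i <- r | P i) F i) <= \sum_(i <- r | P i) nrm (F i).
Proof.
elim/big_rec2: _ => [|i x y _ le]; first by rewrite nrm0.
by apply: le_trans (nrmD _ _) _; rewrite lerD2l.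
Qed.

Local Notation K := (R[i] : numFieldType).
Lemma near_nrm (w : K) (P : set K) :
  (\forall z \near w, P z) <-> exists2 e : R, 0 < e & forall z, nrm (z - w) < e -> P z.
Proof.
split=> [/nbhs_ballP [e /= e0 He]|[e e0 He]].
  have eR : e = (complex.Re e)%:C%C by rewrite RRe_real // gtr0_real.
  exists (complex.Re e); first by rewrite -ltcR -eR.
  move=> z zw; apply: He; rewrite -ball_normE /= distrC nrmE eR ltcR //.
apply/nbhs_ballP; exists e%:C%C => /=; first by rewrite ltcR.
by move=> z; rewrite -ball_normE /= distrC nrmE ltcR; exact: He.
Qed.

Lemma near_dnrm (w : K) (P : set K) :
  (\forall z \near (w^')%classic, P z) <->
  exists2 e : R, 0 < e & forall z, z != w -> nrm (z - w) < e -> P z.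
Proof.
have -> : (\forall z \near (w^')%classic, P z) <-> (\forall z \near w, z != w -> P z) by [].
rewrite near_nrm; split=> -[e e0 He]; exists e => // z h1 h2; exact: He h2 h1.
Qed.

Lemma cvg_nrm (u : nat -> K) (l : K) :
  (u @ \oo --> l)%classic <->
  forall e : R, 0 < e -> exists n0, forall n, (n0 <= n)%N -> nrm (l - u n) < e.
Proof.
split=> [/cvgrPdist_lt H e e0|H].
  have [|n0 _ Hn] := H e%:C%C; first by rewrite ltcR.
  by exists n0 => n /Hn /=; rewrite nrmE ltcR.
apply/cvgrPdist_lt => e e0.
have eR : e = (complex.Re e)%:C%C by rewrite RRe_real // gtr0_real.
have [|n0 Hn] := H (complex.Re e); first by rewrite -ltcR -eR.
exists n0 => // n /= /Hn; by rewrite nrmE eR ltcR.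
Qed.

End Norm.

(** * Taylor series with geometric remainder bounds *)

Section Taylor.
Variable R : realType.
Local Notation C := R[i].
Implicit Types (f g : C -> C) (w z : C) (c d : nat -> C) (M rho : R).

(** Partial sum, of the terms of degree less than [n]. *)
Definition psum c n (z : C) : C := \sum_(k < n) c k * z ^+ k.

Lemma psum0 c z : psum c 0 z = 0. Proof. by rewrite /psum big_ord0. Qed.
Lemma psumS c n z : psum c n.+1 z = psum c n z + c n * z ^+ n.
Proof. by rewrite /psum big_ord_recr. Qed.
Lemma psumSl c n z : psum c n.+1 z = c 0%N + z * psum (fun k => c k.+1) n z.
Proof.
rewrite /psum big_ord_recl expr0 mulr1 mulr_sumr; congr (_ + _).
by apply: eq_bigr => i _; rewrite /= /bump /= add1n exprS mulrCA.
Qed.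
Lemma psum_at0 c n : psum c n.+1 0 = c 0%N.
Proof. by rewrite psumSl mul0r addr0. Qed.
Lemma eq_psum c d n z : (forall k, (k < n)%N -> c k = d k) ->
  psum c n z = psum d n z.
Proof. by move=> H; apply: eq_bigr => i _; rewrite H. Qed.

(** All Taylor remainders of [f] at [w] are controlled, with the same
constants, on the closed disc of radius [1 / rho].  The case [n = 0] bounds
[f] itself. *)
Definition taylor_bound M rho f w c : Prop :=
  forall z, rho * nrm (z - w) <= 1 -> forall n,
    nrm (f z - psum c n (z - w)) <= M * (rho * nrm (z - w)) ^+ n.

(** [f] is analytic at [w] with Taylor coefficients [c]. *)
Definition taylor f w c : Prop :=
  exists M rho, 0 < rho /\ taylor_bound M rho f w c.

Lemma taylor_bound_ge0 M rho f w c : taylor_bound M rho f w c -> 0 <= M.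
Proof.
move=> /(_ w); rewrite subrr nrm0 mulr0 => /(_ ler01 0%N).
by rewrite psum0 subr0 expr0 mulr1; apply: le_trans; rewrite nrm_ge0.
Qed.

Lemma taylor_bound_le M rho M' rho' f w c : 0 <= rho -> rho <= rho' -> M <= M' ->
  taylor_bound M rho f w c -> taylor_bound M' rho' f w c.
Proof.
move=> r0 rr MM H z zr n.
have le1 : rho * nrm (z - w) <= rho' * nrm (z - w) by rewrite ler_wpM2r ?nrm_ge0.
apply: le_trans (H z (le_trans le1 zr) n) _.
have M0 := taylor_bound_ge0 H.
have xn : 0 <= rho * nrm (z - w) by rewrite mulr_ge0 ?nrm_ge0.
apply: ler_pM => //; first by rewrite exprn_ge0.
by rewrite lerXn2r ?nnegrE // (le_trans xn).
Qed.

Lemma taylor_value f w c : taylor f w c -> f w = c 0%N.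
Proof.
move=> [M [rho [r0 /(_ w)]]]; rewrite subrr nrm0 mulr0 => /(_ ler01 1%N).
rewrite psum_at0 expr1 mulr0 => H.
by apply/eqP; rewrite -subr_eq0 -nrm_eq0 eq_le H nrm_ge0.
Qed.

(** Cauchy estimates; the coefficient of order [n] is a difference of two
successive remainders at a point where [rho |z - w| = 1]. *)
Lemma taylor_coef_bound M rho f w c n : 0 < rho -> taylor_bound M rho f w c ->
  nrm (c n) <= 2 * M * rho ^+ n.
Proof.
move=> r0 H.
have [z0 z0E] : exists z, nrm (z - w) = rho^-1.
  exists (w + (rho^-1)%:C%C); rewrite addrC addKr nrmR ger0_norm //.
  by rewrite invr_ge0 ltW.
have e1 : rho * nrm (z0 - w) = 1 by rewrite z0E mulfV // gt_eqF.
have := H z0; rewrite e1 lexx => /(_ isT) Hn.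
have A := Hn n; have B := Hn n.+1; rewrite !expr1n mulr1 psumS in A B.
have : nrm (c n * (z0 - w) ^+ n) <= 2 * M.
  rewrite (_ : _ * _ = (f z0 - psum c n (z0 - w)) -
     (f z0 - (psum c n (z0 - w) + c n * (z0 - w) ^+ n))); last by ring.
  by apply: le_trans (nrmD _ _) _; rewrite nrmN; lra.
rewrite nrmM nrmX z0E exprVn ler_pdivrMr ?exprn_gt0 //.
Qed.

Lemma taylor_ext f g w c :
  (exists2 e : R, 0 < e & forall z, nrm (z - w) < e -> g z = f z) ->
  taylor f w c -> taylor g w c.
Proof.
move=> [e e0 fg] [M [rho [r0 H]]].
exists M, (rho + 2 / e); split; first by rewrite addr_gt0 // divr_gt0.
have e2 : 0 < 2 / e by rewrite divr_gt0.
have H' : taylor_bound M (rho + 2 / e) f w c.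
  by apply: taylor_bound_le H; rewrite ?lerDl // ltW.
move=> z zr n; rewrite fg; first exact: H'.
have : 2 / e * nrm (z - w) <= 1.
  by apply: le_trans zr; rewrite ler_wpM2r ?nrm_ge0 // lerDr ltW.
by rewrite mulrAC ler_pdivrMr // mul1r => h; have := nrm_ge0 (z - w); lra.
Qed.

Lemma taylor_eq f w c d : c =1 d -> taylor f w c -> taylor f w d.
Proof.
move=> cd [M [rho [r0 H]]]; exists M, rho; split=> // z zr n.
by rewrite -(@eq_psum c) //; exact: H.
Qed.

Lemma taylor0 w : taylor (fun=> 0) w (fun=> 0).
Proof.
exists 0, 1; split=> // z _ n; rewrite mul0r /psum big1 ?subr0 ?nrm0 //.
by move=> i _; rewrite mul0r.
Qed.

(** Coefficients of [a + b (z - w) f]. *)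
Lemma taylor_shift (a b : C) f w c : taylor f w c ->
  taylor (fun z => a + b * (z - w) * f z) w
    (fun k => if k is k'.+1 then b * c k' else a).
Proof.
move=> [M [rho [r0 H]]]; have M0 := taylor_bound_ge0 H.
have K0 : 0 <= nrm b * M / rho.
  by rewrite divr_ge0 ?mulr_ge0 ?nrm_ge0 // ltW.
exists (nrm a + nrm b * M / rho), rho; split=> // z zr n.
have x0 : 0 <= rho * nrm (z - w) by rewrite mulr_ge0 ?nrm_ge0 // ltW.
have rE : nrm (z - w) = rho^-1 * (rho * nrm (z - w)) by rewrite mulKf ?gt_eqF.
case: n => [|n].
  rewrite psum0 subr0 expr0 mulr1; apply: le_trans (nrmD _ _) _.
  rewrite lerD2l !nrmM ler_pdivlMr //.
  have := H z zr 0%N; rewrite psum0 subr0 expr0 mulr1 => Hz.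
  rewrite (_ : _ * rho = nrm b * (rho * nrm (z - w) * nrm (f z))); last by ring.
  by rewrite ler_wpM2l ?nrm_ge0 // -[leRHS]mul1r ler_pM ?nrm_ge0.
rewrite psumSl.
rewrite (_ : _ - _ = b * (z - w) * (f z - psum c n (z - w))); last first.
  rewrite (_ : psum _ n _ = b * psum c n (z - w)); last first.
    by rewrite /psum mulr_sumr; apply: eq_bigr => i _; rewrite mulrA.
  by ring.
rewrite !nrmM exprS {1}rE.
have Hn := H z zr n; rewrite mulrDl.
apply: (@le_trans _ _ (nrm b * M / rho * (rho * nrm (z - w) * (rho * nrm (z - w)) ^+ n))).
  set X := rho * _ in x0 Hn *.
  rewrite (_ : nrm b * (rho^-1 * X) * nrm (f z - psum c n (z - w)) =
     nrm b * rho^-1 * X * nrm (f z - psum c n (z - w))); last by ring.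
  rewrite (_ : nrm b * M / rho * (X * X ^+ n) = nrm b / rho * X * (M * X ^+ n)); last by ring.
  by rewrite ler_wpM2l // !mulr_ge0 ?invr_ge0 ?nrm_ge0 // ltW.
by rewrite lerDr mulr_ge0 ?nrm_ge0 // mulr_ge0 // exprn_ge0.
Qed.

(** The difference quotient of [f] at [w], completed by continuity. *)
Lemma taylor_unshift f w c : taylor f w c ->
  taylor (fun z => if z == w then c 1%N else (f z - c 0%N) / (z - w)) w
    (fun k => c k.+1).
Proof.
move=> [M [rho [r0 H]]]; have M0 := taylor_bound_ge0 H.
exists (2 * M * rho), rho; split=> // z zr n.
have x0 : 0 <= rho * nrm (z - w) by rewrite mulr_ge0 ?nrm_ge0 // ltW.
have [->|zw] := eqVneq z w.
  case: n => [|n].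
    rewrite psum0 subr0 expr0 mulr1.
    by have := taylor_coef_bound 1 r0 H; rewrite expr1.
  rewrite subrr psum_at0 subrr nrm0.
  by rewrite mulr0 exprS mul0r mulr0.
rewrite (_ : _ - _ = (f z - psum c n.+1 (z - w)) / (z - w)); last first.
  by rewrite psumSl; field; rewrite subr_eq0.
have nz : 0 < nrm (z - w) by rewrite nrm_gt0 subr_eq0.
rewrite nrmM nrmV ler_pdivrMr //; apply: le_trans (H z zr n.+1) _.
rewrite exprS (_ : M * _ = M * rho * (rho * nrm (z - w)) ^+ n * nrm (z - w)); last by ring.
rewrite ler_wpM2r ?nrm_ge0 // ler_wpM2r ?exprn_ge0 // -mulrA.
by rewrite ler_peMl ?mulr_ge0 ?(ltW r0) //; lra.
Qed.

Lemma taylorD f g w c d : taylor f w c -> taylor g w d ->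
  taylor (fun z => f z + g z) w (fun k => c k + d k).
Proof.
move=> [M [rho [r0 H]]] [M' [rho' [r0' H']]].
exists (M + M'), (rho + rho'); split; first exact: addr_gt0.
have h : taylor_bound M (rho + rho') f w c.
  by apply: taylor_bound_le H; rewrite ?lerDl // ltW.
have h' : taylor_bound M' (rho + rho') g w d.
  by apply: taylor_bound_le H'; rewrite ?lerDr // ltW.
move=> z zr n.
rewrite (_ : _ - _ = (f z - psum c n (z - w)) + (g z - psum d n (z - w))); last first.
  rewrite (_ : psum (fun k => _) n _ = psum c n (z - w) + psum d n (z - w)); last first.
    by rewrite /psum -big_split; apply: eq_bigr => i _; rewrite /= mulrDl.
  by ring.
by apply: le_trans (nrmD _ _) _; rewrite mulrDl lerD ?h ?h'.
Qed.

Lemma taylorZ (a : C) f w c : taylor f w c ->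
  taylor (fun z => a * f z) w (fun k => a * c k).
Proof.
move=> [M [rho [r0 H]]]; exists (nrm a * M), rho; split=> // z zr n.
rewrite (_ : psum (fun k => _) n _ = a * psum c n (z - w)); last first.
  by rewrite /psum mulr_sumr; apply: eq_bigr => i _; rewrite mulrA.
by rewrite -mulrBr nrmM -mulrA ler_wpM2l ?nrm_ge0 ?H.
Qed.

(** [inv_coef_seq c k] lists, in decreasing order of degree, the coefficients
up to degree [k] of the reciprocal of the series [c]. *)
Fixpoint inv_coef_seq c k : seq C :=
  if k is k'.+1 then
    let l := inv_coef_seq c k' in
    (- (c 0%N)^-1 * \sum_(i < k) c i.+1 * l`_i) :: l
  else [:: (c 0%N)^-1].

(** Coefficients of the formal reciprocal of the power series [c], meaningful
when [c 0] is nonzero. *)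
Definition inv_coef c k : C := head 0 (inv_coef_seq c k).

Lemma nth_inv_coef_seq c k i : (i <= k)%N ->
  (inv_coef_seq c k)`_i = inv_coef c (k - i).
Proof.
elim: k i => [|k IH] [|i] //= ik.
by rewrite IH // subSS.
Qed.

Lemma inv_coef0 c : inv_coef c 0 = (c 0%N)^-1. Proof. by []. Qed.

Lemma inv_coefS c k :
  inv_coef c k.+1 = - (c 0%N)^-1 * \sum_(i < k.+1) c i.+1 * inv_coef c (k - i).
Proof.
rewrite {1}/inv_coef /=; congr (_ * _); apply: eq_bigr => i _.
by rewrite nth_inv_coef_seq // -ltnS.
Qed.

Lemma inv_coef_conv c k : c 0%N != 0 ->
  \sum_(i < k.+2) c i * inv_coef c (k.+1 - i) = 0.
Proof.
move=> c0; rewrite big_ord_recl /= subn0 inv_coefS mulrA mulrN mulfV // mulN1r.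
by under [X in _ + X]eq_bigr => i _ do rewrite /bump /= add1n subSS; rewrite addNr.
Qed.

(** A Cauchy product truncated at degree [n], with the inner sums cut so that
no term of higher degree appears. *)
Lemma psum_conv c d n z :
  \sum_(j < n) d j * z ^+ j * psum c (n - j) z =
  psum (fun k => \sum_(i < k.+1) c i * d (k - i)%N) n z.
Proof.
elim: n => [|n IH]; first by rewrite psum0 big_ord0.
rewrite psumS -IH big_ord_recr /= subSnn.
under eq_bigr => j _.
  rewrite subSn; last exact: ltnW.
  rewrite psumS mulrDr; over.
rewrite big_split /= -!addrA; congr (_ + _).
rewrite (_ : psum c 1 z = c (n - n)%N * z ^+ (n - n)); last first.
  by rewrite subnn psumS psum0 add0r.
transitivity (\sum_(j < n.+1) d j * z ^+ j * (c (n - j)%N * z ^+ (n - j))).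
  by rewrite big_ord_recr.
rewrite mulr_suml (reindex_inj rev_ord_inj) /=; apply: eq_bigr => j _.
have jn : (j <= n)%N by rewrite -ltnS.
rewrite subSS subKn //.
have -> : z ^+ n = z ^+ (n - j) * z ^+ j by rewrite -exprD subnK.
by ring.
Qed.

(** The ratio [rho (1 + m / |c 0|)] is the one for which the recursion of
[inv_coef] telescopes. *)
Lemma inv_coef_bound c (m rho : R) : c 0%N != 0 -> 0 <= m -> 0 < rho ->
  (forall k, nrm (c k) <= m * rho ^+ k) ->
  forall k, nrm (inv_coef c k) <= nrm (c 0%N)^-1 *
     (rho * (1 + m * nrm (c 0%N)^-1)) ^+ k.
Proof.
move=> c0 m0 r0 cb; set de := nrm (c 0%N)^-1; set s := rho * _.
have de0 : 0 <= de by rewrite nrm_ge0.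
have mu0 : 0 <= m * de by rewrite mulr_ge0.
have s0 : 0 <= s by rewrite mulr_ge0 ?(ltW r0) // addr_ge0.
elim/ltn_ind => -[|k] IH; first by rewrite inv_coef0 expr0 mulr1.
rewrite inv_coefS nrmM nrmN -/de ler_wpM2l //.
apply: le_trans (nrm_sum _ _ _) _.
have key : \sum_(i < k.+1) rho ^+ i.+1 * (m * de) * s ^+ (k - i) =
           s ^+ k.+1 - rho ^+ k.+1.
  elim: (k) => [|l IHl].
    by rewrite big_ord_recl big_ord0 subnn expr0 !expr1 /s; ring.
  rewrite big_ord_recr /= subnn expr0 mulr1.
  under eq_bigr => i _ do rewrite subSn -1?ltnS // [s ^+ _.+1]exprS mulrCA.
  by rewrite -mulr_sumr IHl [s ^+ l.+2]exprS [rho ^+ l.+2]exprS {1 3}/s; ring.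
have {}key : \sum_(i < k.+1) rho ^+ i.+1 * (m * de) * s ^+ (k - i) <= s ^+ k.+1.
  by rewrite key gerBl exprn_ge0 // ltW.
apply: le_trans key; apply: ler_sum => i _; rewrite nrmM.
apply: (@le_trans _ _ (m * rho ^+ i.+1 * (de * s ^+ (k - i)))).
  by rewrite ler_pM ?nrm_ge0 // IH // ltnS leq_subr.
by rewrite le_eqVlt; apply/orP; left; apply/eqP; ring.
Qed.

End Taylor.

(** * Reciprocals, and the link with convergent power series *)

Section Taylor2.
Variable R : realType.
Local Notation C := R[i].
Implicit Types (f g : C -> C) (w z : C) (c d : nat -> C) (M rho : R).

Lemma natr_le_exp2 n : (n%:R : R) <= 2 ^+ n.
Proof. by rewrite -natrX ler_nat ltnW // ltn_expl. Qed.

Lemma taylorV f w c : c 0%N != 0 -> taylor f w c ->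
  taylor (fun z => (f z)^-1) w (inv_coef c).
Proof.
move=> c0 [M [rho [r0 H]]]; have M0 := taylor_bound_ge0 H.
(* On the disc [s |z - w| <= 1 / 2] the function stays away from [0]. *)
set de := nrm (c 0%N)^-1; set s := rho * (1 + 2 * M * de).
have de0 : 0 < de by rewrite nrm_gt0 invr_eq0.
have Md0 : 0 <= 2 * M * de by rewrite !mulr_ge0 // ltW.
have s0 : 0 < s by rewrite mulr_gt0 // ltr_wpDr.
have db : forall k, nrm (inv_coef c k) <= de * s ^+ k.
  apply: inv_coef_bound => //; first by rewrite mulr_ge0.
  by move=> k; exact: taylor_coef_bound H.
have rs : rho <= s by rewrite /s ler_peMr ?(ltW r0) // lerDl.
exists (2 * de * (1 + de * M)), (2 * s); split; first by rewrite mulr_gt0.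
move=> z; set y := z - w; set x := nrm y => zr n.
have x0 : 0 <= x by exact: nrm_ge0.
have sx0 : 0 <= s * x by rewrite mulr_ge0 // ltW.
have rx0 : 0 <= rho * x by rewrite mulr_ge0 // ltW.
have rsx : rho * x <= s * x by rewrite ler_wpM2r.
have rx1 : rho * x <= 1 by lra.
have fz : (2 * de)^-1 <= nrm (f z).
  have := H z rx1 1%N; rewrite expr1 psumS psum0 add0r expr0 mulr1 -/y -/x => h1.
  have c0E : nrm (c 0%N) = de^-1 by rewrite /de nrmV invrK.
  have : nrm (c 0%N) <= nrm (f z) + nrm (f z - c 0%N).
    rewrite -[X in nrm X <= _](subKr (f z)).
    by apply: le_trans (nrmD _ _) _; rewrite nrmN.
  rewrite c0E => h2.
  have h3 : M * (rho * x) <= (2 * de)^-1.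
    rewrite -[leRHS]mul1r ler_pdivlMr ?mulr_gt0 //.
    apply: le_trans (_ : s * x <= _); last by lra.
    have -> : M * (rho * x) * (2 * de) = rho * x * (2 * M * de) by ring.
    have -> : s * x = rho * x + rho * x * (2 * M * de) by rewrite /s; ring.
    by rewrite lerDr.
  have h4 : (2 * de)^-1 = de^-1 / 2 by rewrite invfM mulrC.
  by rewrite h4 in h3 *; lra.
have fn0 : 0 < nrm (f z) by apply: lt_le_trans fz; rewrite invr_gt0 mulr_gt0.
have f0 : f z != 0 by rewrite -nrm_gt0.
have fV : nrm (f z)^-1 <= 2 * de.
  by rewrite nrmV -[leRHS]invrK lef_pV2 // posrE invr_gt0 mulr_gt0.
case: n => [|n].
  rewrite psum0 subr0 expr0 mulr1 mulrDr mulr1; apply: le_trans fV _.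
  by rewrite lerDl !mulr_ge0 // ltW.
set D := psum _ _ _.
set E := \sum_(j < n.+1) inv_coef c j * y ^+ j * (f z - psum c (n.+1 - j) y).
(* By the choice of [inv_coef], the truncated product with [f] is [1] up to
   the remainders of [f], collected in [E]. *)
have DE : f z * D = 1 + E.
  have -> : 1 = psum (fun k => \sum_(i < k.+1) c i * inv_coef c (k - i)%N) n.+1 y.
    rewrite psumSl big_ord_recl big_ord0 subn0 inv_coef0 mulfV // addr0.
    rewrite (_ : psum _ _ _ = 0) ?mulr0 ?addr0 //.
    by rewrite /psum big1 // => i _; rewrite inv_coef_conv // mul0r.
  rewrite -psum_conv -big_split /= /D /psum mulr_sumr; apply: eq_bigr => j _.
  by rewrite mulrBr addrC subrK mulrC.
have Eb : nrm E <= de * M * (2 * s * x) ^+ n.+1.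
  apply: le_trans (nrm_sum _ _ _) _.
  apply: (@le_trans _ _ (\sum_(j < n.+1) de * M * (s * x) ^+ n.+1)).
    apply: ler_sum => j _; rewrite !nrmM nrmX -/x.
    have hj := H z rx1 (n.+1 - j)%N.
    have jn : (j <= n.+1)%N by exact: ltnW.
    rewrite -/y -/x in hj.
    apply: (@le_trans _ _ (de * s ^+ j * x ^+ j * (M * (s * x) ^+ (n.+1 - j)))).
      apply: ler_pM; rewrite ?mulr_ge0 ?nrm_ge0 ?exprn_ge0 //.
        by rewrite ler_wpM2r ?exprn_ge0.
      by apply: le_trans hj _; rewrite ler_wpM2l // lerXn2r ?nnegrE.
    have -> : (s * x) ^+ n.+1 = (s * x) ^+ (n.+1 - j) * (s * x) ^+ j.
      by rewrite -exprD subnK.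
    by rewrite [(s * x) ^+ j]exprMn le_eqVlt; apply/orP; left; apply/eqP; ring.
  rewrite sumr_const card_ord -[2 * s * x]mulrA [(2 * (s * x)) ^+ _]exprMn.
  rewrite -[_ *+ n.+1]mulr_natr -[_ * n.+1%:R]mulrA.
  rewrite ler_wpM2l ?mulr_ge0 ?(ltW de0) // mulrC ler_wpM2r ?exprn_ge0 //.
  exact: natr_le_exp2.
rewrite (_ : _ - D = (f z)^-1 * - E); last first.
  have -> : E = f z * D - 1 by rewrite DE addrC addKr.
  by field.
rewrite nrmM nrmN.
apply: (@le_trans _ _ (2 * de * (de * M * (2 * s * x) ^+ n.+1))).
  by rewrite ler_pM ?nrm_ge0.
rewrite -[leRHS]mulrA ler_wpM2l ?mulr_ge0 ?(ltW de0) // ler_wpM2r ?lerDr //.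
by rewrite exprn_ge0 // -mulrA mulr_ge0.
Qed.

Local Notation K := (R[i] : numFieldType).

Lemma exprn_small (x e : R) : 0 <= x <= 2^-1 -> 0 < e ->
  exists n0, forall n, (n0 <= n)%N -> x ^+ n < e.
Proof.
move=> /andP[x0 x2] e0; set m := (Num.truncn e^-1).+1; exists m => n mn.
have : x ^+ n <= 2^-1 ^+ n by rewrite lerXn2r // nnegrE ?invr_ge0.
move=> h; apply: le_lt_trans h _; rewrite exprVn -[e]invrK.
rewrite ltf_pV2 ?posrE ?exprn_gt0 ?invr_gt0 //.
apply: lt_le_trans (natr_le_exp2 n).
apply: lt_le_trans (_ : m%:R <= _); last by rewrite ler_nat.
by rewrite truncnS_gt.
Qed.

(** If the terms of the series are bounded at distance [r], then on the disc
of radius [r / 2] the series is dominated by a geometric one of ratio at most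
[1 / 2]. *)
Lemma taylor_bound_series (M r : R) f w c z :
  0 < r -> 0 <= M -> nrm (z - w) <= r / 2 ->
  (forall k, nrm (c k) * r ^+ k <= M) ->
  (forall e, 0 < e -> exists n0, forall n, (n0 <= n)%N ->
     nrm (f z - psum c n (z - w)) < e) ->
  forall n, nrm (f z - psum c n (z - w)) <= 2 * M * (nrm (z - w) / r) ^+ n.
Proof.
move=> r0 M0 zr cb cv n; set y := z - w; set q := nrm y / r.
have q0 : 0 <= q by rewrite divr_ge0 ?nrm_ge0 ?ltW.
have q2 : q <= 2^-1 by rewrite ler_pdivrMr // mulrC.
(* Each new term is at most the decrease of the bound left for the tail. *)
have tail N : nrm (psum c (n + N) y - psum c n y) + 2 * M * q ^+ (n + N) <= 2 * M * q ^+ n.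
  elim: N => [|N IH]; first by rewrite addn0 subrr nrm0 add0r.
  apply: le_trans IH; rewrite addnS psumS addrAC.
  apply: (@le_trans _ _ (nrm (psum c (n + N) y - psum c n y)
      + nrm (c (n + N)%N * y ^+ (n + N)) + 2 * M * q ^+ (n + N).+1)).
    by rewrite lerD2r nrmD.
  rewrite -addrA lerD2l.
  have hc : nrm (c (n + N)%N * y ^+ (n + N)) <= M * q ^+ (n + N).
    rewrite nrmM nrmX /q expr_div_n mulrA ler_pdivlMr ?exprn_gt0 //.
    by rewrite mulrAC ler_wpM2r ?exprn_ge0 ?nrm_ge0.
  have hq : q ^+ (n + N).+1 <= 2^-1 * q ^+ (n + N).
    by rewrite exprS ler_wpM2r ?exprn_ge0.
  have : M * q ^+ (n + N).+1 <= M * (2^-1 * q ^+ (n + N)) by rewrite ler_wpM2l.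
  by lra.
apply/ler_addgt0Pr => e e0; have [n0 Hn0] := cv e e0.
have := Hn0 (n + n0)%N (leq_addl _ _); rewrite -/y => h1.
have := tail n0; set t := _ * q ^+ (n + n0) => h2.
have t0 : 0 <= t by rewrite !mulr_ge0 ?exprn_ge0.
rewrite (_ : f z - _ = (f z - psum c (n + n0) y) + (psum c (n + n0) y - psum c n y)); last by ring.
by apply: le_trans (nrmD _ _) _; lra.
Qed.

Lemma cvg_coef_bound c (y : C) (l : C) :
  (forall e : R, 0 < e -> exists n0, forall n, (n0 <= n)%N ->
     nrm (l - psum c n y) < e) ->
  exists2 M : R, 0 <= M & forall k, nrm (c k) * nrm y ^+ k <= M.
Proof.
move=> /(_ 1 ltr01)[n0 H].
have hb k : nrm (c k) * nrm y ^+ k <= 2 + \sum_(i < n0) nrm (c i) * nrm y ^+ i.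
  have s0 : 0 <= \sum_(i < n0) nrm (c i) * nrm y ^+ i.
    by apply: sumr_ge0 => i _; rewrite mulr_ge0 ?exprn_ge0 ?nrm_ge0.
  have [kn|kn] := ltnP k n0.
    rewrite (bigD1 (Ordinal kn)) //= addrCA lerDl addr_ge0 //.
    by apply: sumr_ge0 => i _; rewrite mulr_ge0 ?exprn_ge0 ?nrm_ge0.
  have h1 := H k kn; have h2 := H k.+1 (leqW kn).
  rewrite -nrmX -nrmM (_ : c k * y ^+ k = (l - psum c k y) - (l - psum c k.+1 y)).
    by apply: le_trans (nrmD _ _) _; rewrite nrmN; lra.
  by rewrite psumS; ring.
exists (2 + \sum_(i < n0) nrm (c i) * nrm y ^+ i) => //.
apply: le_trans (hb 0%N); by rewrite mulr_ge0 ?exprn_ge0 ?nrm_ge0.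
Qed.

(** The converse of [taylor_cvg]: pointwise convergence on a disc already
gives uniform remainder bounds on a smaller one. *)
Lemma taylor_of_cvg f w c (e : R) : 0 < e ->
  (forall z, nrm (z - w) < e ->
    forall e : R, 0 < e -> exists n0, forall n, (n0 <= n)%N ->
     nrm (f z - psum c n (z - w)) < e) ->
  taylor f w c.
Proof.
move=> e0 H; set r := e / 2.
have r0 : 0 < r by rewrite divr_gt0.
have [|M M0 Mb] := @cvg_coef_bound c r%:C%C (f (w + r%:C%C)).
  have := H (w + r%:C%C); rewrite addrC addKr nrmR gtr0_norm //; apply.
  by rewrite /r; lra.
rewrite nrmR gtr0_norm // in Mb.
exists (2 * M), (2 / r); split; first by rewrite divr_gt0.
move=> z zr n.
have zr2 : nrm (z - w) <= r / 2.
  by move: zr; rewrite mulrAC ler_pdivrMr // mul1r; lra.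
apply: le_trans (taylor_bound_series r0 M0 zr2 Mb _ n) _.
  by apply: H; rewrite /r in zr2 *; lra.
have y0 := nrm_ge0 (z - w).
have q0 : 0 <= nrm (z - w) / r by rewrite divr_ge0 ?(ltW r0).
have qq : nrm (z - w) / r <= 2 / r * nrm (z - w) by rewrite mulrAC -mulrA; lra.
by rewrite ler_wpM2l ?mulr_ge0 // lerXn2r ?nnegrE // (le_trans q0).
Qed.

Lemma taylor_cvg f w c : taylor f w c ->
  exists2 e : R, 0 < e & forall z, nrm (z - w) < e ->
    forall e : R, 0 < e -> exists n0, forall n, (n0 <= n)%N ->
     nrm (f z - psum c n (z - w)) < e.
Proof.
move=> [M [rho [r0 H]]]; have M0 := taylor_bound_ge0 H.
exists (2 * rho)^-1; first by rewrite invr_gt0 mulr_gt0.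
move=> z zr e e0.
have y0 := nrm_ge0 (z - w).
have ry : rho * nrm (z - w) <= 2^-1.
  move: zr; rewrite -[X in _ < X]mul1r ltr_pdivlMr ?mulr_gt0 //; lra.
have ry0 : 0 <= rho * nrm (z - w) by rewrite mulr_ge0 // ltW.
have eM : 0 < e / (M + 1) by rewrite divr_gt0 // ltr_wpDl.
have [|n0 Hn0] := @exprn_small (rho * nrm (z - w)) (e / (M + 1)) _ eM.
  by rewrite ry0.
exists n0 => n nn; have ry1 : rho * nrm (z - w) <= 1 by lra.
apply: le_lt_trans (H z ry1 n) _; have := Hn0 n nn.
rewrite ltr_pdivlMr; last by lra.
apply: le_lt_trans; rewrite mulrC ler_wpM2l ?exprn_ge0 //; lra.
Qed.

Lemma analytic_atP f w : @analytic_at R[i] f w <-> exists c, taylor f w c.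
Proof.
split=> [[c /near_nrm [e e0 H]]|[c /taylor_cvg [e e0 H]]]; exists c.
  apply: (taylor_of_cvg e0) => z /H /cvg_nrm Hz d /Hz [n0 Hn]; exists n0 => n /Hn.
  by rewrite /series /= big_mkord.
apply/near_nrm; exists e => // z /H Hz; apply/cvg_nrm => d /Hz [n0 Hn].
by exists n0 => n /Hn; rewrite /series /= big_mkord.
Qed.

End Taylor2.

(** * Minima of continuous functions on rectangles *)

Section MinPrinciple.
Variable R : realType.
Local Notation C := R[i].
Implicit Types (f g : C -> C) (w z p : C) (c d : nat -> C) (M rho : R).
Local Notation Im := complex.Im.
Local Notation Re := complex.Re.

Lemma ImD (a b : C) : Im (a + b) = Im a + Im b. Proof. by case: a; case: b. Qed.
Lemma ImN (a : C) : Im (- a) = - Im a. Proof. by case: a. Qed.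
Lemma ImB (a b : C) : Im (a - b) = Im a - Im b. Proof. by case: a; case: b. Qed.
Lemma ImRM (r : R) (a : C) : Im (r%:C%C * a) = r * Im a.
Proof. by case: a => a b /=; rewrite mul0r addr0. Qed.
Lemma Im_inv (a : C) : Im a^-1 = - Im a / nrm a ^+ 2.
Proof. by case: a => a b; rewrite nrm_sqr /= mulNr. Qed.

(** On the half-plane a term [r / (z - x)] with [r >= 0] has nonpositive
imaginary part, of size at most [r / |z - x|]. *)
Lemma Im_pole (x r : R) z :
  Im (r%:C%C / (z - x%:C%C)) = - (r * Im z / nrm (z - x%:C%C) ^+ 2).
Proof. by rewrite ImRM Im_inv ImB /= subr0 !mulrA mulrN mulNr. Qed.

Lemma taylor_cst (a : C) w : exists c, taylor (fun=> a) w c.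
Proof.
exists (fun k => if k is k'.+1 then 0 * 0 else a).
have := taylor_shift a 0 (taylor0 w); apply: taylor_ext.
by exists 1 => // z _; rewrite mul0r mul0r addr0.
Qed.

Lemma taylor_sub (a : C) w : exists2 c, taylor (fun z => z - a) w c & c 0%N = w - a.
Proof.
have [c Hc] := taylor_cst 1 w.
exists (fun k => if k is k'.+1 then 1 * c k' else w - a) => //.
have := taylor_shift (w - a) 1 Hc; apply: taylor_ext.
by exists 1 => // z _; ring.
Qed.

Lemma taylor_pole (r a : C) w : w != a -> exists c, taylor (fun z => r / (z - a)) w c.
Proof.
move=> wa; have [c Hc c0] := taylor_sub a w.
by eexists; apply/taylorZ/taylorV/Hc; rewrite c0 subr_eq0.
Qed.

(** Continuity at a point of a real-valued function of a complex variable. *)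
Definition cont_at (v : C -> R) p := forall e : R, 0 < e ->
  exists2 d : R, 0 < d & forall z, nrm (z - p) < d -> `|v z - v p| < e.

Lemma taylor_cont f p c : taylor f p c -> forall e : R, 0 < e ->
  exists2 d : R, 0 < d & forall z, nrm (z - p) < d -> nrm (f z - f p) < e.
Proof.
move=> Hf; rewrite (taylor_value Hf); case: Hf => M [rho [r0 H]] e e0.
have M0 := taylor_bound_ge0 H.
have D0 : 0 < rho^-1 by rewrite invr_gt0.
exists (Num.min rho^-1 (e / (M * rho + 1))).
  by rewrite lt_min D0 divr_gt0 // ltr_wpDl // mulr_ge0 // ltW.
move=> z; rewrite lt_min => /andP[h1 h2].
have := H z _ 1%N; rewrite psumS psum0 add0r expr0 mulr1 expr1.
move=> h; apply: le_lt_trans (h _) _.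
  by rewrite -ler_pdivlMl // mulr1 ltW.
move: h2; rewrite ltr_pdivlMr; last by rewrite ltr_wpDl // mulr_ge0 // ltW.
have := nrm_ge0 (z - p); lra.
Qed.

Lemma Im_taylor_cont f p c : taylor f p c -> cont_at (fun z => Im (f z)) p.
Proof.
move=> /taylor_cont H e /H [d d0 Hd]; exists d => // z /Hd.
by apply: le_lt_trans; rewrite -ImB Im_le_nrm.
Qed.

Lemma cont_at_sqr (a : C) (k : R) p : cont_at (fun z => k * nrm (z - a) ^+ 2) p.
Proof.
move=> e e0; set b := nrm (p - a); have b0 : 0 <= b by exact: nrm_ge0.
set D := (`|k| + 1) * (2 * b + 1).
have k0 := normr_ge0 k.
have D0 : 0 < D by rewrite mulr_gt0 //; lra.
exists (Num.min 1 (e / D)); first by rewrite lt_min ltr01 divr_gt0.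
move=> z; rewrite lt_min ltr_pdivlMr // => /andP[h1 h2].
have h0 := nrm_ge0 (z - p).
rewrite -mulrBr normrM subr_sqr normrM.
have t1 : `|nrm (z - a) - b| <= nrm (z - p).
  have i1 := nrmD (z - p) (p - a); have i2 := nrmD (p - z) (z - a).
  rewrite subrKA -/b in i1; rewrite subrKA -/b [nrm (p - z)]nrmB in i2.
  by rewrite ler_norml; apply/andP; split; lra.
have t2 : `|nrm (z - a) + b| <= 2 * b + 1.
  rewrite ger0_norm ?addr_ge0 ?nrm_ge0 //.
  by move: t1; rewrite ler_norml => /andP[_]; lra.
apply: le_lt_trans (_ : `|k| * (nrm (z - p) * (2 * b + 1)) < e).
  by rewrite ler_wpM2l // ler_pM.
apply: le_lt_trans h2; rewrite /D mulrCA ler_wpM2l // ler_wpM2r //; lra.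
Qed.

Lemma cont_atB (u v : C -> R) p : cont_at u p -> cont_at v p ->
  cont_at (fun z => u z - v z) p.
Proof.
move=> hu hv e e0; have e2 : 0 < e / 2 by lra.
have [d1 d10 H1] := hu _ e2; have [d2 d20 H2] := hv _ e2.
exists (Num.min d1 d2); first by rewrite lt_min d10.
move=> z; rewrite lt_min => /andP[/H1 h1 /H2 h2].
rewrite (_ : _ - _ = (u z - u p) - (v z - v p)); last by ring.
by apply: le_lt_trans (ler_normB _ _) _; lra.
Qed.

Lemma rect_min (v : C -> R) (a b c d : R) : a <= b -> c <= d ->
  (forall p, a <= Re p <= b -> c <= Im p <= d -> cont_at v p) ->
  exists p, [/\ a <= Re p <= b, c <= Im p <= d &
    forall z, a <= Re z <= b -> c <= Im z <= d -> v p <= v z].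
Proof.
move=> ab cd Hv.
pose A : set (R * R) := (`[a, b]%classic `*` `[c, d]%classic)%classic.
pose V (q : R * R) := v (q.1 +i* q.2)%C.
have A0 : (A !=set0)%classic.
  by exists (a, c); split; rewrite /= in_itv /= lexx.
have cA : compact A by apply: compact_setX; apply: segment_compact.
have cV : {within A, continuous V}%classic.
  apply: continuous_in_subspaceT => -[s t]; rewrite inE => -[/=].
  rewrite !in_itv /= => hs ht.
  apply/cvgrPdist_lt => e e0.
  have [r r0 H] := Hv (s +i* t)%C hs ht e e0.
  have d2 : 0 < r / 2 by lra.
  exists (ball s (r / 2), ball t (r / 2)); first by split; exact: nbhsx_ballx.
  move=> [s' t'] [/=]; rewrite -ball_normE /= => h1 h2.
  rewrite distrC; apply: H.
  have -> : ((s' +i* t') - (s +i* t))%C = (s' - s)%:C%C + ('i%C * (t' - t)%:C%C).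
    by apply/eqP; rewrite eq_complex /=; apply/andP; split; apply/eqP; ring.
  apply: le_lt_trans (nrmD _ _) _; rewrite nrmM !nrmR.
  rewrite nrm_i mul1r [`|s' - _|]distrC [`|t' - _|]distrC.
  by lra.
have [[s t] sA Hmin] := compact_EVT_min A0 cA cV.
move: sA; rewrite inE => -[/=]; rewrite !in_itv /= => hs ht.
exists (s +i* t)%C; split=> // -[s' t'] /= hs' ht'.
by apply: (Hmin (s', t')); rewrite inE; split; rewrite /= in_itv.
Qed.

End MinPrinciple.

(** * A minimum principle: removing a boundary pole *)

Section PoleRemoval.
Variable R : realType.
Local Notation C := R[i].
Implicit Types (f g : C -> C) (w z p : C) (c d : nat -> C) (M rho : R).
Local Notation Im := complex.Im.
Local Notation Re := complex.Re.

(** The mean of [f] over the four points [p + e i^k] equals [f p] up to third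
order. *)
Lemma four_point f p c : taylor f p c ->
  exists B e0 : R, [/\ 0 <= B, 0 < e0 & forall e : R, 0 < e <= e0 ->
    nrm (f (p + e%:C%C) + f (p - e%:C%C) + f (p + 'i%C * e%:C%C)
       + f (p - 'i%C * e%:C%C) - f p *+ 4) <= B * e ^+ 3].
Proof.
move=> Hf; rewrite (taylor_value Hf); case: Hf => M [rho [r0 H]].
have M0 := taylor_bound_ge0 H.
exists (4 * M * rho ^+ 3), rho^-1; split.
- by rewrite !mulr_ge0 ?exprn_ge0 // ?ltW.
- by rewrite invr_gt0.
move=> e /andP[e0 e1].
pose r y := f (p + y) - psum c 3 y.
have rb y : nrm y = e -> nrm (r y) <= M * (rho * e) ^+ 3.
  move=> ye; have := H (p + y); rewrite [p + y - p]addrC addKr ye; apply.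
  by rewrite -ler_pdivlMl // mulr1.
have n1 : nrm (e%:C%C : C) = e by rewrite nrmR gtr0_norm.
have n2 : nrm (- e%:C%C : C) = e by rewrite nrmN.
have n3 : nrm ('i%C * e%:C%C : C) = e by rewrite nrmM nrm_i mul1r.
have n4 : nrm (- ('i%C * e%:C%C) : C) = e by rewrite nrmN.
(* The terms of degree one and two cancel, because [i^2 = -1]. *)
rewrite (_ : _ - _ = r e%:C%C + r (- e%:C%C) + r ('i%C * e%:C%C)
                     + r (- ('i%C * e%:C%C))); last first.
  rewrite /r !psumS !psum0.
  have i2 : 'i%C ^+ 2 = -1 :> C by rewrite sqr_i.
  have := i2; set u := e%:C%C; set j := 'i%C => ij.
  rewrite !exprMn !sqrrN !exprMn ij; ring.
have h1 := rb _ n1; have h2 := rb _ n2; have h3 := rb _ n3; have h4 := rb _ n4.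
have t1 := nrmD (r e%:C%C + r (- e%:C%C) + r ('i%C * e%:C%C)) (r (- ('i%C * e%:C%C))).
have t2 := nrmD (r e%:C%C + r (- e%:C%C)) (r ('i%C * e%:C%C)).
have t3 := nrmD (r e%:C%C) (r (- e%:C%C)).
have -> : 4 * M * rho ^+ 3 * e ^+ 3 = 4 * (M * (rho * e) ^+ 3) by rewrite exprMn; ring.
set N := M * (rho * e) ^+ 3 in h1 h2 h3 h4 *.
rewrite (_ : 4 * N = N + N + N + N); last by ring.
have s3 := le_trans t3 (lerD h1 h2); have s2 := le_trans t2 (lerD s3 h3).
exact: le_trans t1 (lerD s2 h4).
Qed.

(** The imaginary part of an analytic function, minus a positive multiple of
the squared distance to [a], has no local minimum. *)
Lemma no_interior_min f p c (a : C) (k : R) : taylor f p c -> 0 < k ->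
  ~ (exists2 d : R, 0 < d & forall z, nrm (z - p) < d ->
      Im (f p) - k * nrm (p - a) ^+ 2 <= Im (f z) - k * nrm (z - a) ^+ 2).
Proof.
move=> /four_point [B [e0 [B0 e00 HB]]] k0 [d d0 Hd].
set e := Num.min e0 (Num.min (d / 2) (k / (B + 1))).
have k1 : 0 < k / (B + 1) by rewrite divr_gt0 // ltr_wpDl.
have e_gt0 : 0 < e by rewrite !lt_min e00 k1 divr_gt0.
have ee0 : e <= e0 by rewrite ge_min lexx.
have ed : e < d.
  have : e <= d / 2 by rewrite !ge_min lexx orbT.
  lra.
have ek : e * (B + 1) <= k.
  rewrite -ler_pdivlMr; last by rewrite ltr_wpDl.
  by rewrite !ge_min lexx !orbT.
have := HB e; rewrite e_gt0 ee0 => /(_ isT) h.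
have n1 : nrm (e%:C%C : C) = e by rewrite nrmR gtr0_norm.
have n2 : nrm (- e%:C%C : C) = e by rewrite nrmN.
have n3 : nrm ('i%C * e%:C%C : C) = e by rewrite nrmM nrm_i mul1r.
have n4 : nrm (- ('i%C * e%:C%C) : C) = e by rewrite nrmN.
have Hy y : nrm y = e ->
    Im (f p) - k * nrm (p - a) ^+ 2 <= Im (f (p + y)) - k * nrm (p + y - a) ^+ 2.
  by move=> ye; apply: Hd; rewrite [p + y - p]addrC addKr ye.
have h1 := Hy _ n1; have h2 := Hy _ n2; have h3 := Hy _ n3; have h4 := Hy _ n4.
have sq : nrm (p + e%:C%C - a) ^+ 2 + nrm (p - e%:C%C - a) ^+ 2 +
   nrm (p + 'i%C * e%:C%C - a) ^+ 2 + nrm (p - 'i%C * e%:C%C - a) ^+ 2 =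
   4 * nrm (p - a) ^+ 2 + 4 * e ^+ 2.
  by rewrite !nrm_sqr; case: (p) (a) => p1 p2 [a1 a2] /=; ring.
have := le_trans (Im_le_nrm _) h; rewrite ler_norml => /andP[_].
rewrite ImB (_ : Im (f p *+ 4) = 4 * Im (f p)); last first.
  by rewrite !mulrS mulr0n !ImD /=; ring.
rewrite !ImD => hI.
have : k * (4 * e ^+ 2) <= B * e ^+ 3.
  move: h1 h2 h3 h4 sq hI.
  move: (Im (f (p + e%:C%C))) (Im (f (p - e%:C%C))) (Im (f (p + 'i%C * e%:C%C)))
    (Im (f (p - 'i%C * e%:C%C))) (Im (f p)) (nrm (p + e%:C%C - a) ^+ 2)
    (nrm (p - e%:C%C - a) ^+ 2) (nrm (p + 'i%C * e%:C%C - a) ^+ 2)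
    (nrm (p - 'i%C * e%:C%C - a) ^+ 2) (nrm (p - a) ^+ 2) (e ^+ 2) (B * e ^+ 3).
  move=> i1 i2 i3 i4 i5 q1 q2 q3 q4 q5 e2 be h1 h2 h3 h4 sq hI.
  have := congr1 (fun t => k * t) sq; rewrite /= !mulrDr; lra.
have : B * e ^+ 3 <= k * e ^+ 2.
  rewrite exprS mulrA ler_wpM2r ?exprn_ge0 ?(ltW e_gt0) //; nra.
have : 0 < k * e ^+ 2 by rewrite mulr_gt0 // exprn_gt0.
lra.
Qed.

(** No behaviour of [f] on the rest of the real line is needed: away from [x]
the pole term tends to [0] at the boundary, uniformly. *)
Lemma pole_removal f (x r : R) (l : C) :
  (forall z, 0 < Im z -> exists c, taylor f z c) ->
  (forall z, 0 < Im z -> 0 <= Im (f z)) -> 0 <= r ->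
  (forall e : R, 0 < e -> exists2 d : R, 0 < d & forall z, 0 < Im z ->
     nrm (z - x%:C%C) < d -> nrm (f z + r%:C%C / (z - x%:C%C) - l) < e) ->
  forall z, 0 < Im z -> 0 <= Im (f z + r%:C%C / (z - x%:C%C)).
Proof.
move=> fT fP r0 fl.
pose g z := f z + r%:C%C / (z - x%:C%C).
have low z : 0 < Im z -> - (r * Im z / nrm (z - x%:C%C) ^+ 2) <= Im (g z).
  by move=> z0; rewrite /g ImD Im_pole lerDr fP.
have Imx z : Im (z - x%:C%C) = Im z by rewrite ImB subr0.
have nz z : 0 < Im z -> 0 < nrm (z - x%:C%C).
  by move=> z0; apply: lt_le_trans (Im_le_nrm _); rewrite Imx gtr0_norm.
have gT z : 0 < Im z -> exists c, taylor g z c.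
  move=> z0; have [c Hc] := fT z z0.
  have [|d Hd] := @taylor_pole R r%:C%C x%:C%C z; last by eexists; exact: taylorD Hc Hd.
  by rewrite -subr_eq0 -nrm_gt0 nz.
(* Approaching [x] along points close to the real axis, where the pole term is
   almost real, shows that the limit has nonnegative imaginary part. *)
have l0 : 0 <= Im l.
  rewrite leNgt; apply/negP => l0.
  have e0 : 0 < - Im l / 2 by lra.
  have [d d0 Hd] := fl _ e0.
  set s := (r + 1).
  have s0 : 0 < s by rewrite /s; lra.
  pose y := Num.min (d / 4) (- Im l / 2 * (d / 2) ^+ 2 / s).
  have y0 : 0 < y by rewrite lt_min !divr_gt0 // mulr_gt0 // exprn_gt0 // divr_gt0.
  have yd : y <= d / 4 by rewrite ge_min lexx.
  have ys : y * s <= - Im l / 2 * (d / 2) ^+ 2.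
    by rewrite -ler_pdivlMr // ge_min lexx orbT.
  pose z := ((x + d / 2) +i* y)%C.
  have z0 : 0 < Im z by [].
  have nE : nrm (z - x%:C%C) ^+ 2 = (d / 2) ^+ 2 + y ^+ 2 by rewrite nrm_sqr /=; ring.
  have nd : nrm (z - x%:C%C) < d.
    by rewrite -(ltr_pXn2r (n:=2)) ?nnegrE ?nrm_ge0 ?(ltW d0) // nE; nra.
  have := Hd z z0 nd; rewrite -/(g z) => h.
  have := le_lt_trans (Im_le_nrm _) h; rewrite ImB ltr_norml => /andP[_ h2].
  have := low z z0; rewrite nE /= => h3.
  have h4 : r * y / ((d / 2) ^+ 2 + y ^+ 2) <= - Im l / 2.
    have q0 : 0 < (d / 2) ^+ 2 by rewrite exprn_gt0 // divr_gt0.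
    rewrite ler_pdivrMr; last by rewrite ltr_wpDr // sqr_ge0.
    have : 0 <= - Im l / 2 * y ^+ 2 by rewrite mulr_ge0 ?sqr_ge0 ?ltW.
    by move: ys; rewrite /s; lra.
  by move: h2 h3 h4; lra.
move=> p p0; rewrite leNgt; apply/negP; rewrite -/(g p) => gp.
set h := - Im (g p); have h0 : 0 < h by rewrite /h; lra.
have h20 : 0 < h / 2 by lra.
have [d d0 Hd] := fl _ h20.
set s := r + 1; have s0 : 0 < s by rewrite /s; lra.
pose y0 := h / 2 * d ^+ 2 / s.
pose B := 2 * r / h + 1.
have B0 : 0 < B by rewrite /B ltr_wpDl // divr_ge0 ?mulr_ge0 // ltW.
have y00 : 0 < y0 by rewrite divr_gt0 // mulr_gt0 // exprn_gt0.
(* Outside the rectangle, a value as low as [- h] is impossible: near [x]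
   because of [l0], and elsewhere because the pole term is small near the real
   axis and at infinity. *)
have outer z : 0 < Im z -> (Im z <= y0) || (B <= nrm (z - x%:C%C)) -> - (h / 2) <= Im (g z).
  move=> z0 hz; have [zd|zd] := ltP (nrm (z - x%:C%C)) d.
    have := le_lt_trans (Im_le_nrm _) (Hd z z0 zd).
    by rewrite -/(g z) ImB ltr_norml => /andP[+ _]; lra.
  apply: le_trans (low z z0); rewrite lerN2.
  rewrite ler_pdivrMr ?exprn_gt0 ?nz //.
  case/orP: hz => hz.
    have t1 : d ^+ 2 <= nrm (z - x%:C%C) ^+ 2 by rewrite lerXn2r ?nnegrE ?nrm_ge0 ?(ltW d0).
    have t2 : y0 * s = h / 2 * d ^+ 2 by rewrite /y0 mulfVK // gt_eqF.
    have t3 : h / 2 * d ^+ 2 <= h / 2 * nrm (z - x%:C%C) ^+ 2 by rewrite ler_wpM2l // ltW.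
    have t4 : r * Im z <= s * y0 by rewrite ler_pM ?(ltW z0) // /s; lra.
    by rewrite mulrC in t4; lra.
  have n0 := nz z z0; set n := nrm _ in hz n0 *.
  have t1 : Im z <= n by apply: le_trans (Im_le_nrm _); rewrite Imx ler_norm.
  have t2 : r <= h / 2 * n.
    apply: le_trans (_ : h / 2 * B <= _); last by rewrite ler_wpM2l // ltW.
    rewrite (_ : h / 2 * B = r + h / 2) ?lerDl ?(ltW h20) //.
    by rewrite /B; field; rewrite gt_eqF.
  by rewrite expr2 mulrA ler_pM // ltW.
have py : y0 < Im p.
  rewrite ltNge; apply/negP => hp; have := outer p p0; rewrite hp => /(_ isT).
  by rewrite /h in h0 *; lra.
have pB : nrm (p - x%:C%C) < B.
  rewrite ltNge; apply/negP => hp; have := outer p p0; rewrite hp orbT => /(_ isT).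
  by rewrite /h in h0 *; lra.
have Im_n z : Im z <= nrm (z - x%:C%C).
  by apply: le_trans (Im_le_nrm _); rewrite Imx ler_norm.
have Re_n z : `|Re z - x| <= nrm (z - x%:C%C).
  by apply: le_trans (Re_le_nrm _); case: (z).
(* This makes the penalty at most [h / 8] on the rectangle. *)
pose k := h / (16 * B ^+ 2).
have k0 : 0 < k by rewrite divr_gt0 // mulr_gt0 // exprn_gt0.
pose v z := Im (g z) - k * nrm (z - x%:C%C) ^+ 2.
have inrect z : y0 < Im z -> nrm (z - x%:C%C) < B ->
   (x - B <= Re z <= x + B) && (y0 <= Im z <= B).
  move=> z1 z2; have a1 := Im_n z; have a2 := Re_n z.
  move: a2; rewrite ler_norml => /andP[a2 a3].
  by apply/andP; split; apply/andP; split; lra.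
have [||z hz1 hz2|q [q1 q2 qmin]] := @rect_min R v (x - B) (x + B) y0 B.
- lra.
- by have := Im_n p; lra.
- have z0 : 0 < Im z by case/andP: hz2; lra.
  have [c Hc] := gT z z0.
  by apply: cont_atB; [exact: Im_taylor_cont Hc|exact: cont_at_sqr].
have q0 : 0 < Im q by case/andP: q2; lra.
have vp : v q <= - h.
  have /andP[p1 p2] := inrect p py pB.
  apply: le_trans (qmin p p1 p2) _; rewrite /v /h opprK gerBl.
  by rewrite mulr_ge0 ?sqr_ge0 // ltW.
have gq : Im (g q) < - (h / 2).
  have : k * nrm (q - x%:C%C) ^+ 2 <= h / 8.
    have : nrm (q - x%:C%C) ^+ 2 <= 2 * B ^+ 2.
      rewrite nrm_sqr Imx (_ : Re _ = Re q - x); last by case: (q).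
      by case/andP: q1 => ? ?; case/andP: q2 => ? ?; nra.
    move=> hq; apply: le_trans (_ : k * (2 * B ^+ 2) <= _).
      by rewrite ler_wpM2l // ltW.
    by rewrite /k le_eqVlt; apply/orP; left; apply/eqP; field; rewrite gt_eqF.
  by move: vp; rewrite /v; lra.
have qy : y0 < Im q.
  by rewrite ltNge; apply/negP => hp; have := outer q q0; rewrite hp => /(_ isT); lra.
have qB : nrm (q - x%:C%C) < B.
  by rewrite ltNge; apply/negP => hp; have := outer q q0; rewrite hp orbT => /(_ isT); lra.
have [c Hc] := gT q q0.
apply: (no_interior_min (a := x%:C%C) Hc k0).
exists (Num.min (Im q - y0) (B - nrm (q - x%:C%C))).
  by rewrite lt_min !subr_gt0 qy.
move=> z; rewrite lt_min => /andP[z1 z2].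
have a1 : Im q - Im z <= nrm (z - q).
  by rewrite nrmB; apply: le_trans (Im_le_nrm _); rewrite ImB ler_norm.
have a2 : nrm (z - x%:C%C) <= nrm (z - q) + nrm (q - x%:C%C).
  by apply: le_trans (nrmD _ _); rewrite subrKA.
have /andP[b1 b2] : (x - B <= Re z <= x + B) && (y0 <= Im z <= B).
  by apply: inrect; lra.
exact: qmin.
Qed.

End PoleRemoval.

(** * Strict positivity of the imaginary part *)

Section Positivity.
Variable R : realType.
Local Notation C := R[i].
Implicit Types (f g : C -> C) (w z p : C) (c d : nat -> C) (M rho : R).
Local Notation Im := complex.Im.
Local Notation Re := complex.Re.

(** The set where a nonnegative imaginary part vanishes is open.  If [f] is
not constant near [p], the first nonconstant term [c k (z - p)^k] can be given
negative imaginary part by choosing the direction of [z - p]. *)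
Lemma Im_zero_open f p c : taylor f p c ->
  (exists2 d : R, 0 < d & forall z, nrm (z - p) < d -> 0 <= Im (f z)) ->
  Im (f p) = 0 ->
  exists2 d : R, 0 < d & forall z, nrm (z - p) < d -> Im (f z) = 0.
Proof.
move=> Hf [d d0 Hd]; rewrite (taylor_value Hf) => I0.
have [cz|/existsNP cn] := pselect (forall k, c k.+1 = 0).
  have [e e0 He] := taylor_cvg Hf; exists e => // z /He Hz.
  suff -> : f z = c 0%N by [].
  apply/eqP; rewrite -subr_eq0 -nrm_eq0; apply/eqP/le_anti; rewrite nrm_ge0 andbT.
  apply/ler_addgt0Pr => h h0; rewrite add0r; have [n0 Hn] := Hz h h0.
  have := Hn n0.+1 (leqnSn _); rewrite psumSl /psum big1 ?mulr0 ?addr0; last first.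
    by move=> i _; rewrite cz mul0r.
  exact: ltW.
have ex : exists k, (c k.+1 != 0) by case: cn => k /eqP; exists k.
pose k := ex_minn ex.
have [ck kmin] : c k.+1 != 0 /\ forall j, (j < k)%N -> c j.+1 = 0.
  rewrite /k; case: ex_minnP => j cj jmin; split=> // i ij.
  by apply/eqP; apply: contraTT ij => /jmin; rewrite -leqNgt.
set a := c k.+1 in ck *.
(* Then [a * ze ^+ k.+1 = - i |a|^2]. *)
pose ze : C := k.+1.-root (- 'i%C * (a^*)%C).
have zeE : ze ^+ k.+1 = - 'i%C * (a^*)%C by rewrite rootCK.
have aze : Im (a * ze ^+ k.+1) = - nrm a ^+ 2.
  by rewrite zeE nrm_sqr; case: (a) => a1 a2 /=; ring.
have a0 : 0 < nrm a ^+ 2 by rewrite exprn_gt0 // nrm_gt0.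
case: Hf => M [rho [r0 H]]; have M0 := taylor_bound_ge0 H.
set N := nrm ze; have N0 : 0 <= N := nrm_ge0 ze.
pose B := M * (rho * N) ^+ k.+2.
have B0 : 0 <= B by rewrite mulr_ge0 // exprn_ge0 // mulr_ge0 // ltW.
pose e := Num.min (d / (N + 1) / 2) (Num.min ((rho * (N + 1))^-1) (nrm a ^+ 2 / (B + 1) / 2)).
have rN : 0 < rho * (N + 1) by rewrite mulr_gt0 // ltr_wpDl.
have N1 : 0 < N + 1 by rewrite ltr_wpDl.
have B1 : 0 < B + 1 by rewrite ltr_wpDl.
have e0 : 0 < e by rewrite !lt_min invr_gt0 rN !divr_gt0.
have e1 : e * (N + 1) < d.
  have : e <= d / (N + 1) / 2 by rewrite ge_min lexx.
  by rewrite mulrAC ler_pdivlMr // => h; lra.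
have e2 : rho * (e * (N + 1)) <= 1.
  have : e <= (rho * (N + 1))^-1 by rewrite !ge_min lexx orbT.
  by rewrite -[X in _ <= X]mul1r ler_pdivlMr // mulrCA.
have e3 : e * (B + 1) < nrm a ^+ 2.
  have : e <= nrm a ^+ 2 / (B + 1) / 2 by rewrite !ge_min lexx !orbT.
  by rewrite mulrAC ler_pdivlMr // => h; lra.
pose y : C := e%:C%C * ze.
have ny : nrm y = e * N by rewrite nrmM nrmR gtr0_norm.
have yz : p + y - p = y by rewrite addrC addKr.
have := Hd (p + y); rewrite yz ny.
have -> : e * N < d by apply: le_lt_trans e1; rewrite ler_wpM2l ?lerDl // ltW.
move=> /(_ isT) fpos.
have := H (p + y); rewrite yz ny.
have -> : rho * (e * N) <= 1.
  by apply: le_trans e2; rewrite ler_wpM2l ?(ltW r0) // ler_wpM2l ?lerDl // ltW.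
move=> /(_ isT k.+2); rewrite psumS psumSl (_ : psum _ k y = 0); last first.
  by rewrite /psum big1 // => i _; rewrite kmin // mul0r.
rewrite mulr0 addr0 -/a => /(le_trans (Im_le_nrm _)); rewrite ler_norml => /andP[_].
rewrite ImB ImD I0 add0r (_ : a * y ^+ k.+1 = (e ^+ k.+1)%:C%C * (a * ze ^+ k.+1)); last first.
  by rewrite /y exprMn -rmorphXn /= mulrCA.
rewrite ImRM aze (_ : M * _ = B * e ^+ k.+2); last by rewrite /B [rho * (e * N)]mulrCA exprMn; ring.
rewrite [e ^+ k.+2]exprS; set E := e ^+ k.+1; have E0 : 0 < E by rewrite exprn_gt0.
move=> h; have : E * (nrm a ^+ 2) <= E * (e * B) by lra.
rewrite ler_pM2l // => h'; exfalso; lra.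
Qed.

(** Along a segment from a zero [p] of the imaginary part to [q], the last
zero on the segment contradicts [Im_zero_open]. *)
Lemma pick_pos f q :
  (forall z, 0 < Im z -> exists c, taylor f z c) ->
  (forall z, 0 < Im z -> 0 <= Im (f z)) ->
  0 < Im q -> 0 < Im (f q) -> forall p, 0 < Im p -> 0 < Im (f p).
Proof.
move=> fT fP q0 fq p p0; rewrite lt_neqAle fP // andbT; apply/eqP => /esym fp.
pose ga (t : R) : C := p + t%:C%C * (q - p).
have gaI t : Im (ga t) = (1 - t) * Im p + t * Im q.
  by rewrite ImD ImRM ImB; ring.
have ga0 t : 0 <= t <= 1 -> 0 < Im (ga t).
  move=> /andP[t0 t1]; rewrite gaI.
  have [->|tn] := eqVneq t 0; first by rewrite subr0 mul1r mul0r addr0.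
  by rewrite ltr_wpDl ?mulr_ge0 ?subr_ge0 ?(ltW p0) // mulr_gt0 // lt_neqAle eq_sym tn.
have gaB t s : nrm (ga t - ga s) = `|t - s| * nrm (q - p).
  by rewrite -nrmR -nrmM; congr nrm; rewrite /ga rmorphB /=; ring.
set L := nrm (q - p) in gaB.
have L0 : 0 < L.
  by rewrite nrm_gt0 subr_eq0; apply: contraTneq fq => ->; rewrite fp ltxx.
pose S : set R := [set t | 0 <= t <= 1 /\ Im (f (ga t)) = 0]%classic.
have S0 : S 0 by split; rewrite ?lexx ?ler01 // /ga mul0r addr0.
have supS : has_sup S.
  by split; [exists 0|exists 1 => t [/andP[]]].
set T := sup S.
have T0 : 0 <= T by apply: ub_le_sup => //; case: supS.
have T1 : T <= 1 by apply: ge_sup; [exists 0|move=> t [/andP[]]].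
(* [T] is the supremum of the zeros on the segment, and it will turn out to be
   a zero. *)
have T01 : 0 <= T <= 1 by rewrite T0.
have [c Hc] := fT _ (ga0 T T01).
have fT0 : Im (f (ga T)) = 0.
  apply/eqP; rewrite eq_le fP ?ga0 // andbT leNgt; apply/negP => fTpos.
  have [d d0 Hd] := Im_taylor_cont Hc fTpos.
  have dL : 0 < d / L by rewrite divr_gt0.
  have [t [/andP[t0 t1] ft] tT] := sup_adherent dL supS.
  have tleT : t <= T by apply: ub_le_sup; [case: supS|split=> //; apply/andP].
  have := Hd (ga t); rewrite gaB -ltr_pdivlMr // distrC ger0_norm ?subr_ge0 //.
  rewrite ltrBlDr addrC -ltrBlDr -/T in tT *.
  by move=> /(_ tT); rewrite ft sub0r normrN gtr0_norm // ltxx.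
have T_1 : T < 1.
  rewrite lt_neqAle T1 andbT; apply: contraTneq fq => TE.
  by move: fT0; rewrite /ga TE mul1r addrC subrK => ->; rewrite ltxx.
have [d d0 Hd] : exists2 d : R, 0 < d & forall z, nrm (z - ga T) < d -> Im (f z) = 0.
  apply: Im_zero_open Hc _ fT0.
  exists (Im (ga T)); first exact: ga0.
  move=> z h; apply: fP.
  have := le_lt_trans (Im_le_nrm _) h; rewrite ImB ltr_norml => /andP[+ _]; lra.
pose t := Num.min 1 (T + d / L / 2).
have dL : 0 < d / L by rewrite divr_gt0.
have tT : T < t by rewrite lt_min T_1 /=; lra.
have t1 : t <= 1 by rewrite ge_min lexx.
have : S t.
  split; first by rewrite t1 andbT; lra.
  apply: Hd; rewrite gaB -ltr_pdivlMr // gtr0_norm ?subr_gt0 //.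
  have : t <= T + d / L / 2 by rewrite ge_min lexx orbT.
  lra.
by move=> /(@ub_le_sup _ S) -/(_ (proj2 supS)); rewrite -/T; lra.
Qed.

End Positivity.

(** * Laurent expansions at a real point *)

Section Laurent.
Variable R : realType.
Local Notation C := R[i].
Implicit Types (f g F G : C -> C) (w z p : C) (c d : nat -> C) (M rho : R) (L : int -> C).
Local Notation Im := complex.Im.
Local Notation Re := complex.Re.
Local Notation K := (R[i] : numFieldType).

Lemma taylor_exp (a : C) n w : exists c, taylor (fun z => a * z ^+ n) w c.
Proof.
elim: n => [|n [c Hc]].
  have [c Hc] := taylor_cst a w; exists c.
  by apply: taylor_ext Hc; exists 1 => // z _; rewrite mulr1.
eexists; have := taylorD (taylorZ w Hc) (taylor_shift 0 1 Hc).
apply: taylor_ext; exists 1 => // z _; rewrite exprS; ring.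
Qed.

(** For a pole of order at least two the leading term takes values of negative
imaginary part in the half-plane. *)
Lemma pole_direction (c : C) n : c != 0 -> (1 < n)%N ->
  exists2 ze : C, 0 < Im ze & Im (c / ze ^+ n) < 0.
Proof.
(* A root with nonnegative imaginary part exists since [n > 1]; a small upward
   shift makes it positive.  The direction is the inverse of the conjugate. *)
move=> c0 n1; pose et := n.-root ('i%C * c).
have et0 : 0 <= Im et.
  by rewrite -ler0c complexIm Im_rootC_ge0.
have ec : 0 < Im ((c^*)%C * et ^+ n).
  rewrite rootCK; last exact: ltnW.
  have : 0 < nrm c ^+ 2 by rewrite exprn_gt0 // nrm_gt0.
  by rewrite nrm_sqr; case: (c) => a b /=; lra.
have [d Hd] := taylor_exp (c^*)%C n et.
have [e e0 He] := Im_taylor_cont Hd ec.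
pose h := et + 'i%C * (e / 2)%:C%C.
have hI : 0 < Im h by rewrite /h ImD /=; lra.
have h0 : h != 0 by apply: contraTneq hI => ->; rewrite ltxx.
have hc : 0 < Im ((c^*)%C * h ^+ n).
  have := He h; rewrite /h [_ + _ - _]addrC addKr nrmM nrm_i nrmR mul1r -/h.
  rewrite gtr0_norm; last by lra.
  have -> : e / 2 < e by lra.
  by move=> /(_ isT); rewrite ltr_norml => /andP[+ _]; lra.
exists ((h^*)%C)^-1.
  rewrite Im_inv mulr_gt0 //; last by rewrite invr_gt0 exprn_gt0 // nrm_gt0 conjc_eq0.
  by case: (h) hI => a b /=; rewrite opprK.
rewrite exprVn invrK (_ : c * _ = (((c^*)%C * h ^+ n)^*)%C); last first.
  by rewrite !rmorphM /= rmorphXn /= conjcK.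
by case: (_ * _) hc => a b /=; lra.
Qed.

(** Factoring out a zero of order [m]. *)
Lemma taylor_unshift_iter G w c m : taylor G w c ->
  (forall k, (k < m)%N -> c k = 0) ->
  exists2 G', taylor G' w (fun k => c (k + m)%N) &
    forall z, z != w -> G z = (z - w) ^+ m * G' z.
Proof.
move=> HG; elim: m => [|m IH] cm.
  exists G; last by move=> z _; rewrite mul1r.
  by apply: taylor_eq HG => k; rewrite addn0.
have [k km|G' HG' GE] := IH; first by apply: cm; exact: ltnW.
have := taylor_unshift HG'; set G'' := (X in taylor X) => HG''.
exists G''; first by apply: taylor_eq HG'' => k; rewrite addSnnS.
move=> z zw; rewrite GE // /G'' (negbTE zw) add0n cm // subr0 exprSr.
by field; rewrite subr_eq0.
Qed.

(** Multiplying by [(z - w)^N] turns a Laurent expansion into a Taylor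
expansion. *)
Lemma laurent_taylor F w L : laurent_expansion (F : K -> K) (w : K) L ->
  exists N G, [/\ forall k : int, k < - N%:Z -> L k = 0,
    taylor G w (fun k => L (k%:Z - N%:Z)) &
    exists2 e : R, 0 < e & forall z, z != w -> nrm (z - w) < e ->
      G z = (z - w) ^+ N * F z].
Proof.
move=> [N [LN /near_dnrm [e e0 He]]].
pose G z := if z == w then L (- N%:Z) else (z - w) ^+ N * F z.
exists N, G; split=> //; last first.
  by exists e => // z zw _; rewrite /G (negbTE zw).
apply: (taylor_of_cvg e0) => z zE.
rewrite /G; have [->|zw] := eqVneq z w => h h0.
  by exists 1%N => -[//|n] _; rewrite subrr psum_at0 sub0r subrr nrm0.
have y0 : z - w != 0 by rewrite subr_eq0.
have n0 : 0 < nrm (z - w) ^+ N by rewrite exprn_gt0 // nrm_gt0.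
have /cvg_nrm H := He z zw zE.
have [|m Hm] := H (h / nrm (z - w) ^+ N); first by rewrite divr_gt0.
exists m => n /Hm; rewrite ltr_pdivlMr // -nrmX -nrmM /series /= big_mkord.
congr (nrm _ < _); rewrite mulrBl mulrC; congr (_ - _).
rewrite mulr_suml /psum; apply: eq_bigr => i _.
by rewrite -mulrA (exprnP (z - w) N) -expfzDr // subrK.
Qed.

(** A Pick function that is meromorphic at [x] is a simple pole term plus a
function analytic at [x], whose Taylor coefficients are the Laurent
coefficients of nonnegative index. *)
Lemma laurent_pick f (x : R) L :
  (forall z, 0 < Im z -> 0 <= Im (f z)) ->
  has_laurent_coefs (@upper_half_plane R) (f : K -> K) (x%:C%C : K) L ->
  exists F1, [/\ taylor F1 x%:C%C (fun k => L k%:Z),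
    exists2 e : R, 0 < e & forall z, nrm (z - x%:C%C) < e -> exists c, taylor F1 z c &
    exists2 e : R, 0 < e & forall z, nrm (z - x%:C%C) < e -> 0 < Im z ->
      f z = L (-1) / (z - x%:C%C) + F1 z].
Proof.
move=> fP [F [/near_nrm [e1 e10 Ff] /near_dnrm [e2 e20 FA]]].
move=> /laurent_taylor [N [G [LN HG [e3 e30 GF]]]].
set w : C := x%:C%C in Ff FA HG GF *.
have cz k : (k.+1 < N)%N -> L (k%:Z - N%:Z) = 0.
  elim/ltn_ind: k => k IH kN; apply/eqP; apply/negPn/negP => ck.
  (* Let [k] be the first index with a nonzero coefficient, so that the pole
     has order [n = N - k >= 2]. *)
  have [|G' HG' GE] := taylor_unshift_iter (m := k) HG.
    by move=> j jk; apply: IH => //; apply: ltn_trans kN; rewrite ltnS.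
  set n := (N - k)%N; have n1 : (1 < n)%N by rewrite /n; lia.
  have [ze zeI cze] := pole_direction ck n1.
  have ze0 : ze != 0 by apply: contraTneq zeI => ->; rewrite ltxx.
  have nz0 : 0 < nrm ze by rewrite nrm_gt0.
  set a := L _ in ck cze.
  have q0 : 0 < - Im (a / ze ^+ n) * nrm ze ^+ n.
    by rewrite mulr_gt0 ?exprn_gt0 // oppr_gt0.
  have [d d0 Hd] := taylor_cont HG' q0.
  pose t := Num.min d (Num.min e1 e3) / (nrm ze + 1).
  have z1 : 0 < nrm ze + 1 by rewrite ltr_wpDl // ltW.
  have t0 : 0 < t by rewrite divr_gt0 // !lt_min d0 e10.
  pose y : C := t%:C%C * ze.
  have : nrm y < Num.min d (Num.min e1 e3).
    rewrite /y nrmM nrmR gtr0_norm // -ltr_pdivlMl // mulrC.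
    by rewrite /t invf_div mulrCA divff ?mulr1 ?ltrDl // gt_eqF // !lt_min d0 e10.
  rewrite !lt_min => /and3P[yd y1 y3].
  have wyw : w + y - w = y by rewrite addrC addKr.
  have yI : 0 < Im (w + y) by rewrite ImD ImRM /= add0r mulr_gt0.
  have y0 : y != 0 by rewrite mulf_neq0 // -nrm_gt0 nrmR gtr0_norm.
  have wy : w + y != w by rewrite -subr_eq0 wyw.
  have := GE _ wy; rewrite GF ?wyw // Ff ?wyw // => E.
  have {}E : f (w + y) = ((t ^+ n)^-1)%:C%C * (G' (w + y) / ze ^+ n).
    have tC : t%:C%C != 0 :> C by rewrite -nrm_gt0 nrmR gtr0_norm.
    have kn : N = (k + n)%N by rewrite /n subnKC // ltnW // ltnW.
    have yn : y ^+ n = (t ^+ n)%:C%C * ze ^+ n by rewrite exprMn rmorphXn.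
    have tn : (t ^+ n)%:C%C != 0 :> C by rewrite rmorphXn /= expf_neq0.
    apply: (mulfI (expf_neq0 N y0)); apply: etrans E _.
    rewrite [in RHS]kn exprD -mulrA yn; congr (_ * _); rewrite fmorphV.
    have key (u v s : C) : s != 0 -> v != 0 -> u = s * v * (s^-1 * (u / v)).
      by move=> s0 v0; field; rewrite s0 v0.
    exact: key tn (expf_neq0 n ze0).
  have := fP _ yI; rewrite E ImRM pmulr_rge0 ?invr_gt0 ?exprn_gt0 // => G0.
  have := Hd (w + y); rewrite wyw => /(_ yd).
  rewrite (taylor_value HG') add0n -/a => h.
  have : nrm ((G' (w + y) - a) / ze ^+ n) < - Im (a / ze ^+ n).
    by rewrite nrmM nrmV nrmX ltr_pdivrMr ?exprn_gt0.
  move=> /(le_lt_trans (Im_le_nrm _)); rewrite mulrBl ImB ltr_norml => /andP[_].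
  by lra.
have [F1 HF1 F1E] : exists2 F1, taylor F1 w (fun k => L k%:Z) &
   forall z, z != w -> nrm (z - w) < e3 -> F z = L (-1) / (z - w) + F1 z.
  case: N LN HG GF cz => [|N] LN HG GF cz.
    exists G; first by apply: taylor_eq HG => k; rewrite subr0.
    by move=> z zw ze; rewrite LN // mul0r add0r GF // mul1r.
  have [k kN|G' HG' GE] := taylor_unshift_iter (m := N) HG; first exact: cz.
  have := taylor_unshift HG'; rewrite !add0n; set F1 := (X in taylor X) => HF1.
  exists F1.
    by apply: taylor_eq HF1 => k; congr L; lia.
  move=> z zw ze; have y0 : z - w != 0 by rewrite subr_eq0.
  have : (z - w) ^+ N * G' z = (z - w) ^+ N.+1 * F z by rewrite -GE // GF.
  rewrite exprSr -mulrA => /(mulfI (expf_neq0 _ y0)) GE'.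
  rewrite /F1 (negbTE zw) (_ : N%:Z - N.+1%:Z = -1); last by lia.
  by rewrite GE'; field.
exists F1; split=> //.
  exists (Num.min e2 e3); first by rewrite lt_min e20.
  move=> z; rewrite lt_min => /andP[z2 z3].
  have [->|zw] := eqVneq z w; first by eexists; exact: HF1.
  have /analytic_atP [c Hc] := FA z zw z2.
  have [d Hd] := taylor_pole (- L (-1)) zw.
  exists (fun k => c k + d k); apply: taylor_ext (taylorD Hc Hd).
  exists (Num.min (nrm (z - w)) (e3 - nrm (z - w))).
    by rewrite lt_min nrm_gt0 subr_eq0 zw subr_gt0.
  move=> u; rewrite lt_min => /andP[u1 u2].
  have uw : u != w by apply: contraTneq u1 => ->; rewrite nrmB ltxx.
  rewrite F1E //; first by rewrite mulNr; ring.
  have := nrmD (u - z) (z - w); rewrite subrKA; lra.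
exists (Num.min e1 e3); first by rewrite lt_min e10.
move=> z; rewrite lt_min => /andP[z1 z3] z0.
have zw : z != w by apply: contraTneq z0 => ->; rewrite ltxx.
by rewrite -(Ff z z1 z0) F1E.
Qed.

Lemma has_laurent_of_taylor f F1 (x : R) (r : C) c :
  taylor F1 x%:C%C c ->
  (exists2 e : R, 0 < e & forall z, nrm (z - x%:C%C) < e -> exists d, taylor F1 z d) ->
  (exists2 e : R, 0 < e & forall z, nrm (z - x%:C%C) < e -> 0 < Im z ->
      f z = r / (z - x%:C%C) + F1 z) ->
  has_laurent_coefs (@upper_half_plane R) (f : K -> K) (x%:C%C : K)
    (fun k => match k with Posz k => c k | Negz 0 => r | _ => 0 end).
Proof.
set w : C := x%:C%C; set L := (X in has_laurent_coefs _ _ _ X) => HF1 [e1 e10 FA] [e2 e20 fE].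
exists (fun z => r / (z - w) + F1 z); split.
- by apply/near_nrm; exists e2 => // z z2 z0; rewrite fE.
- apply/near_dnrm; exists e1 => // z zw ze; apply/analytic_atP.
  have [d Hd] := FA z ze; have [b Hb] := taylor_pole r zw.
  by eexists; exact: taylorD Hb Hd.
exists 1%N; split; first by move=> [|[]].
have [e e0 He] := taylor_cvg HF1.
apply/near_dnrm; exists e => // z zw ze; apply/cvg_nrm => h h0.
have [n0 Hn] := He z ze h h0; exists n0.+1 => -[//|n]; rewrite ltnS => /Hn.
rewrite /series /= big_mkord big_ord_recl.
rewrite (_ : \sum_(i < n) _ = psum c n (z - w)); last first.
  apply: eq_bigr => i _; rewrite lift0.
  by rewrite (_ : i.+1%:Z - 1%:Z = i%:Z) // -addn1 PoszD addrK.
rewrite (_ : L _ * _ = r / (z - w)) //.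
by rewrite opprD addrACA subrr add0r.
Qed.

End Laurent.

(** * Julia reduction and augmentation *)

Section Julia.
Variable R : realType.
Local Notation C := R[i].
Implicit Types (f g F G h H : C -> C) (w z p : C) (c d : nat -> C) (M rho : R) (x s t : R).
Local Notation Im := complex.Im.
Local Notation Re := complex.Re.

(** The Pick class, with analyticity expressed by Taylor remainders. *)
Definition pick_fun f := (forall z, 0 < Im z -> exists c, taylor f z c) /\
  (forall z, 0 < Im z -> 0 <= Im (f z)).

(** [f], known on the half-plane, extends analytically to a neighbourhood of
the real point [x], with Taylor coefficients [c] there. *)
Definition boundary_taylor f x c := exists F, [/\ taylor F x%:C%C c,
  exists2 e : R, 0 < e & forall z, nrm (z - x%:C%C) < e -> exists d, taylor F z d &
  exists2 e : R, 0 < e & forall z, nrm (z - x%:C%C) < e -> 0 < Im z -> F z = f z].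

(** The inverse of the Julia reduction: the function with value [s] and
derivative [t] at [x] whose reduction is [h]. *)
Definition augment s t x h z : C :=
  s%:C%C + t%:C%C * (z - x%:C%C) / (1 - t%:C%C * (z - x%:C%C) * h z).

Lemma pick_neq x z : 0 < Im z -> z - x%:C%C != 0.
Proof.
move=> z0; have : 0 < Im (z - x%:C%C) by rewrite ImB subr0.
by apply: contraTneq => ->; rewrite ltxx.
Qed.

Lemma real_neq0 t : t != 0 -> t%:C%C != 0 :> C.
Proof. by move=> t0; rewrite -nrm_eq0 nrmR normr_eq0. Qed.

Lemma taylor_near_neq0 f p c : taylor f p c -> f p != 0 ->
  exists2 e : R, 0 < e & forall z, nrm (z - p) < e -> f z != 0.
Proof.
move=> Hf; rewrite -nrm_gt0 => fp; have [d d0 Hd] := taylor_cont Hf fp.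
exists d => // z /Hd; apply: contraTneq => ->.
by rewrite sub0r nrmN ltxx.
Qed.

Lemma taylor_negV f p c : taylor f p c -> f p != 0 ->
  exists d, taylor (fun z => - (f z)^-1) p d.
Proof.
move=> Hf fp; have c0 : c 0%N != 0 by rewrite -(taylor_value Hf).
eexists; have := taylorZ (-1) (taylorV c0 Hf); apply: taylor_ext.
by exists 1 => // z _; rewrite mulN1r.
Qed.

Lemma taylor_subcst f p c (a : C) : taylor f p c ->
  exists d, taylor (fun z => f z - a) p d.
Proof.
by move=> Hf; have [d Hd] := taylor_cst (- a) p; eexists; exact: taylorD Hf Hd.
Qed.

(** A positive derivative at a real boundary value forces the imaginary part
to be positive just above [x], hence everywhere. *)
Lemma pick_positive f x c t : pick_fun f -> boundary_taylor f x c ->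
  Im (c 0%N) = 0 -> c 1%N = t%:C%C -> 0 < t ->
  forall z, 0 < Im z -> 0 < Im (f z).
Proof.
move=> [fT fP] [F [[M [rho [r0 HM]]] _ [e e0 Ff]]] c0 c1 t0.
have M0 := taylor_bound_ge0 HM.
pose B := M * rho ^+ 2; have B0 : 0 <= B by rewrite mulr_ge0 // exprn_ge0 // ltW.
pose y := Num.min (e / 2) (Num.min rho^-1 (t / (B + 1) / 2)).
have B1 : 0 < B + 1 by rewrite ltr_wpDl.
have y0 : 0 < y by rewrite !lt_min invr_gt0 r0 !divr_gt0.
have y1 : y < e.
  have : y <= e / 2 by rewrite ge_min lexx.
  by lra.
have y2 : rho * y <= 1 by rewrite -ler_pdivlMl // mulr1 !ge_min lexx orbT.
have y3 : y * (B + 1) < t.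
  have : y <= t / (B + 1) / 2 by rewrite !ge_min lexx !orbT.
  by rewrite mulrAC ler_pdivlMr // => h; lra.
pose v : C := 'i%C * y%:C%C.
have nv : nrm v = y by rewrite nrmM nrm_i mul1r nrmR gtr0_norm.
pose q := x%:C%C + v.
have qx : q - x%:C%C = v by rewrite /q addrC addKr.
have q0 : 0 < Im q by rewrite /q ImD /=; lra.
apply: (pick_pos fT fP q0); rewrite -Ff ?qx ?nv //.
have := HM q; rewrite qx nv => /(_ y2 2%N).
rewrite !psumS psum0 add0r expr0 mulr1 expr1 c1.
move=> /(le_trans (Im_le_nrm _)); rewrite ler_norml => /andP[+ _].
rewrite ImB ImD c0 add0r ImRM /=.
rewrite (_ : M * _ = y * (y * B)); last by rewrite /B exprMn; ring.
rewrite !(mul0r, mul1r, addr0, add0r, mulr0).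
have : y * (y * B) < y * t by rewrite ltr_pM2l //; lra.
lra.
Qed.

Lemma julia_reduce f x c s t : pick_fun f -> boundary_taylor f x c ->
  c 0%N = s%:C%C -> c 1%N = t%:C%C -> 0 < t ->
  exists h c', [/\ pick_fun h, boundary_taylor h x c',
    forall z, 0 < Im z -> f z = augment s t x h z &
    forall k, c k.+2 = t%:C%C * \sum_(i < k.+1) c i.+1 * c' (k - i)%N].
Proof.
move=> fpick fbd c0 c1 t0; have c0I : Im (c 0%N) = 0 by rewrite c0.
have fpos := pick_positive fpick fbd c0I c1 t0.
case: fpick fbd => fT fP [F [FT [e1 e10 FA] [e2 e20 Ff]]].
set w : C := x%:C%C in FT FA Ff *; set sC : C := s%:C%C in c0 *; set tC : C := t%:C%C in c1 *.
have tC0 : tC != 0 by apply: real_neq0; rewrite gt_eqF.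
have fs z : 0 < Im z -> f z - sC != 0.
  move=> /fpos fz; have : 0 < Im (f z - sC) by rewrite ImB /= subr0.
  by apply: contraTneq => ->; rewrite ltxx.
(* With [F - s = (z - x) phi] and [psi = 1 / phi], the reduction is [(1 / t -
   psi) / (z - x)], that is [H]. *)
have phiT := taylor_unshift FT; set phi := (X in taylor X) in phiT.
have psiT := taylorV (c := fun k => c k.+1) (etrans (congr1 (fun u => u != 0) c1) tC0) phiT.
set d := inv_coef _ in psiT; have d0 : d 0%N = tC^-1 by rewrite /d inv_coef0 c1.
have HT := taylorZ (-1) (taylor_unshift psiT).
set H := (X in taylor X) in HT.
have phi0 : phi w != 0 by rewrite /phi eqxx c1.
have [e3 e30 phin] := taylor_near_neq0 phiT phi0.
have HE z : z != w -> phi z != 0 -> H z = - (F z - sC)^-1 + tC^-1 / (z - w).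
  move=> zw; rewrite /H (negbTE zw) d0 /phi (negbTE zw) c0.
  rewrite mulf_eq0 invr_eq0 negb_or => /andP[n1 n2].
  by field; rewrite n1 n2 tC0.
pose P z := - (f z - sC)^-1.
have PT z : 0 < Im z -> exists c, taylor P z c.
  move=> z0; have [c' Hc] := fT z z0; have [b Hb] := taylor_subcst sC Hc.
  exact: taylor_negV Hb (fs z z0).
have PP z : 0 < Im z -> 0 <= Im (P z).
  move=> z0; rewrite /P ImN Im_inv mulNr opprK ImB subr0.
  by rewrite divr_ge0 ?sqr_ge0 // fP.
pose h z := P z + (t^-1)%:C%C / (z - w).
have tV : (t^-1)%:C%C = tC^-1 by rewrite fmorphV.
have hH : exists2 e : R, 0 < e & forall z, nrm (z - w) < e -> 0 < Im z -> H z = h z.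
  exists (Num.min e2 e3); first by rewrite lt_min e20.
  move=> z; rewrite lt_min => /andP[z2 z3] z0.
  have zw : z != w by rewrite -subr_eq0 pick_neq.
  by rewrite HE ?phin // /h /P Ff // tV.
have hP z : 0 < Im z -> 0 <= Im (h z).
  apply: (@pole_removal R P x t^-1 (H w)) => //; first by rewrite invr_ge0 ltW.
  move=> e e0; have [e4 e40 hH'] := hH; have [e5 e50 Hcont] := taylor_cont HT e0.
  exists (Num.min e4 e5); first by rewrite lt_min e40.
  move=> u u0; rewrite lt_min => /andP[u4 u5].
  by rewrite -/(h u) -hH' // Hcont.
exists h; eexists; split.
- split=> // z z0; have [c' Hc] := PT z z0.
  have zw : z != w by rewrite -subr_eq0 pick_neq.
  have [b Hb] := taylor_pole (t^-1)%:C%C zw.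
  by eexists; exact: taylorD Hc Hb.
- exists H; split; [exact: HT| |exact: hH].
  exists (Num.min e1 e3); first by rewrite lt_min e10.
  move=> z; rewrite lt_min => /andP[z1 z3].
  have [->|zw] := eqVneq z w; first by eexists; exact: HT.
  have [b Hb] := FA z z1; have [b1 Hb1] := taylor_subcst sC Hb.
  have phz := phin z z3.
  have Fs : F z - sC != 0.
    by move: phz; rewrite /phi (negbTE zw) c0 mulf_eq0 negb_or => /andP[].
  have [b2 Hb2] := taylor_negV Hb1 Fs.
  have [b3 Hb3] := taylor_pole tC^-1 zw.
  eexists; apply: taylor_ext (taylorD Hb2 Hb3).
  exists (Num.min (nrm (z - w)) (e3 - nrm (z - w))).
    by rewrite lt_min nrm_gt0 subr_eq0 zw subr_gt0.
  move=> u; rewrite lt_min => /andP[u1 u2].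
  have uw : u != w by apply: contraTneq u1 => ->; rewrite nrmB ltxx.
  rewrite HE // phin //.
  have := nrmD (u - z) (z - w); rewrite subrKA; lra.
- move=> z z0; have fz := fs z z0; have zw := pick_neq x z0.
  rewrite /augment -/sC -/tC -/w /h /P tV.
  have -> : 1 - tC * (z - w) * (- (f z - sC)^-1 + tC^-1 / (z - w)) = tC * (z - w) / (f z - sC).
    by field; rewrite fz zw tC0.
  by field; rewrite fz zw tC0.
move=> k /=.
have := @inv_coef_conv R (fun k => c k.+1) k; rewrite c1 => /(_ tC0).
rewrite big_ord_recr /= subnn -/d d0 => /eqP; rewrite addrC addr_eq0 => /eqP E.
rewrite -[LHS](mulfVK tC0) E mulrC -sumrN; congr (_ * _); apply: eq_bigr => i _.
by rewrite mulN1r mulrN subSn // -ltnS.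
Qed.

Section Augment.
Variables (h : C -> C) (x s t : R) (c' : nat -> C).
Hypotheses (hpick : pick_fun h) (t0 : 0 < t).
Local Notation w := (x%:C%C : C).
Local Notation sC := (s%:C%C : C).
Local Notation tC := (t%:C%C : C).

Lemma Im_sub_pole z : 0 < Im z -> 0 < Im (h z - tC^-1 / (z - w)).
Proof.
move=> z0; rewrite ImB -fmorphV Im_pole opprK ltr_wpDl //; first by case: hpick => _ ->.
rewrite divr_gt0 //; first by rewrite mulr_gt0 // invr_gt0.
by rewrite exprn_gt0 // nrm_gt0 pick_neq.
Qed.

Lemma augment_denom_neq0 z : 0 < Im z -> 1 - tC * (z - w) * h z != 0.
Proof.
move=> z0; have zw := pick_neq x z0.
have tC0 : tC != 0 by apply: real_neq0; rewrite gt_eqF.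
have -> : 1 - tC * (z - w) * h z = - (tC * (z - w)) * (h z - tC^-1 / (z - w)).
  by field; rewrite zw tC0.
rewrite mulf_neq0 ?oppr_eq0 ?mulf_neq0 //.
by apply: contraTneq (Im_sub_pole z0) => ->; rewrite ltxx.
Qed.

(** [augment] is also [s - 1 / (h - 1 / (t (z - x)))], which shows it is in
the Pick class. *)
Lemma augmentE (v u : C) : u != 0 -> 1 - tC * u * v != 0 ->
  sC + tC * u / (1 - tC * u * v) = sC - (v - tC^-1 / u)^-1.
Proof.
move=> u0 n0; have tC0 : tC != 0 by apply: real_neq0; rewrite gt_eqF.
have n1 : v - tC^-1 / u != 0.
  apply: contraNneq n0 => n1.
  have -> : 1 - tC * u * v = - (tC * u) * (v - tC^-1 / u) by field; rewrite u0 tC0.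
  by rewrite n1 mulr0.
have -> : 1 - tC * u * v = - (tC * u) * (v - tC^-1 / u) by field; rewrite u0 tC0.
move: (v - _) n1 => V n1; field.
by rewrite n1 u0 tC0.
Qed.

Lemma pick_augment : pick_fun (augment s t x h).
Proof.
split=> z z0; last first.
  rewrite /augment augmentE ?pick_neq ?augment_denom_neq0 //.
  rewrite ImB Im_inv mulNr opprK /= add0r divr_ge0 ?sqr_ge0 //.
  exact/ltW/Im_sub_pole.
have [c Hc] := hpick.1 z z0.
have zw : z != w by rewrite -subr_eq0 pick_neq.
have [b Hb] := taylor_pole (- tC^-1) zw.
have Hq := taylorD Hc Hb.
have q0 : h z + - tC^-1 / (z - w) != 0.
  rewrite mulNr.
  by apply: contraTneq (Im_sub_pole z0) => ->; rewrite ltxx.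
have [b1 Hb1] := taylor_negV Hq q0.
have [b2 Hb2] := taylor_cst sC z.
eexists; apply: taylor_ext (taylorD Hb2 Hb1).
exists (Im z) => // u uz.
have u0 : 0 < Im u.
  have := le_lt_trans (Im_le_nrm _) uz; rewrite ImB ltr_norml => /andP[+ _]; lra.
by rewrite /augment augmentE ?pick_neq ?augment_denom_neq0 // mulNr.
Qed.

Hypothesis hbd : boundary_taylor h x c'.

Lemma boundary_augment : exists c, [/\ boundary_taylor (augment s t x h) x c,
   c 0%N = sC, c 1%N = tC &
   forall k, c k.+2 = tC * \sum_(i < k.+1) c i.+1 * c' (k - i)%N].
Proof.
have [H [HT [e1 e10 HA] [e2 e20 Hh]]] := hbd.
have uT := taylor_shift 1 (- tC) HT; set u := (X in taylor X) in uT.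
set cu := (X in taylor _ _ X) in uT.
have cu0 : cu 0%N != 0 by rewrite /cu oner_neq0.
have vT := taylorV cu0 uT; set d := inv_coef cu in vT.
have FT := taylor_shift sC tC vT; set F := (X in taylor X) in FT.
have d0 : d 0%N = 1 by rewrite /d inv_coef0 /cu invr1.
have FE z : F z = augment s t x H z by rewrite /F /augment /u !mulNr.
have u0 : u w != 0 by rewrite (taylor_value uT).
have [e3 e30 un] := taylor_near_neq0 uT u0.
eexists; split; [exists F; split; [exact: FT| | ] | by [] | by rewrite -[RHS]mulr1 -d0 | ].
- exists (Num.min e1 e3); first by rewrite lt_min e10.
  move=> z; rewrite lt_min => /andP[z1 z3].
  have [->|zw] := eqVneq z w; first by eexists; exact: FT.
  have zw0 : z - w != 0 by rewrite subr_eq0.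
  have [c Hc] := HA z z1.
  have [b Hb] := taylor_pole (- tC^-1) zw.
  have Hq := taylorD Hc Hb.
  have tC0 : tC != 0 by apply: real_neq0; rewrite gt_eqF.
  have q0 : H z + - tC^-1 / (z - w) != 0.
    apply: contraNneq (un z z3) => q0.
    have -> : u z = - (tC * (z - w)) * (H z + - tC^-1 / (z - w)).
      by rewrite /u; field; rewrite zw0 tC0.
    by rewrite q0 mulr0.
  have [b1 Hb1] := taylor_negV Hq q0.
  have [b2 Hb2] := taylor_cst sC z.
  eexists; apply: taylor_ext (taylorD Hb2 Hb1).
  exists (Num.min (nrm (z - w)) (e3 - nrm (z - w))).
    by rewrite lt_min nrm_gt0 subr_eq0 zw subr_gt0.
  move=> y; rewrite lt_min => /andP[y1 y2].
  have yw : y != w by apply: contraTneq y1 => ->; rewrite nrmB ltxx.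
  have yn : nrm (y - w) < e3 by have := nrmD (y - z) (z - w); rewrite subrKA; lra.
  have uy : 1 - tC * (y - w) * H y != 0 by have := un y yn; rewrite /u !mulNr.
  have yw0 : y - w != 0 by rewrite subr_eq0.
  by rewrite FE /augment augmentE // mulNr.
- exists e2 => // z z2 z0; rewrite FE /augment.
  by rewrite Hh.
move=> k; congr (_ * _).
have := @inv_coef_conv R cu k cu0; rewrite big_ord_recl /= subn0 mul1r -/d => /eqP.
rewrite addr_eq0 => /eqP ->; rewrite -sumrN (reindex_inj rev_ord_inj) /=.
apply: eq_bigr => i _; have ik : (i <= k)%N by rewrite -ltnS.
by rewrite /bump /= add1n !subSS subKn // add0n; ring.
Qed.

End Augment.
End Julia.

(** * Descent of Hankel positivity *)

Section Hankel.
Variable R : realType.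
Implicit Types (b c : nat -> R) (m n i j k : nat).

(** The recursion relating the Taylor coefficients [b] of a function to the
coefficients [c] of its Julia reduction, for the first [N] entries of [c]. *)
Definition julia_rec b c N := forall k, (k < N)%N ->
  b k.+2 = b 1%N * \sum_(i < k.+1) b i.+1 * c (k - i)%N.

Lemma reduce_data_rec N b : b 1%N != 0 -> julia_rec b (reduce_data N b) N.
Proof.
move=> b1 k kN; have /colP/(_ (Ordinal kN)) := reduce_dataP N b1.
rewrite !mxE /= => <-; congr (_ * _).
rewrite [RHS](reindex_inj rev_ord_inj) /=.
rewrite (big_ord_widen N (fun i => b (k.+1 - i.+1).+1%N * reduce_data N b (k - (k.+1 - i.+1))%N)) //.
rewrite [RHS]big_mkcond /=; apply: eq_bigr => i _; rewrite !mxE ltnS.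
case: leqP => ik; last by rewrite mul0r.
by rewrite subSS subKn.
Qed.

(** The matrix [hankel] for data indexed by natural numbers. *)
Definition hankel_seq m b : 'M[R]_m := \matrix_(i < m, j < m) b (i + j).+1%N.

(** The entrywise form of the factorisation in [hankel_seq_descent].  The left
side depends on [i + j] only, and by the recursion so does the right side; for
[j = 0] both are [b (i + 1)]. *)
Lemma hankel_conv b c i j : b 1%N != 0 -> julia_rec b c (i + j) ->
  b (i + j).+1%N = b i.+1 * b j.+1 / b 1%N +
    \sum_(p < i) \sum_(q < j) b (i - p)%N * b (j - q)%N * c (p + q).+1%N.
Proof.
move=> b1; pose U k := \sum_(p < k) b (k - p)%N * c p.+1.
have rec k N : julia_rec b c N -> (k < N)%N ->
    b k.+2 = b 1%N * (b k.+1 * c 0%N + U k).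
  move=> H /H ->; rewrite big_ord_recr /= subnn addrC; congr (_ * (_ + _)).
  rewrite (reindex_inj rev_ord_inj) /=; apply: eq_bigr => p _.
  by rewrite subnSK // subKn // ltnW.
elim: j i => [|j IH] i Hrec.
  rewrite big1 ?addr0; last by move=> p _; rewrite big_ord0.
  by rewrite addn0 mulfK.
pose W := \sum_(p < i) \sum_(q < j) b (i - p)%N * b (j - q)%N * c (p + q).+2%N.
have -> : \sum_(p < i) \sum_(q < j.+1) b (i - p)%N * b (j.+1 - q)%N * c (p + q).+1%N
    = b j.+1 * U i + W.
  rewrite /W mulr_sumr -big_split /=; apply: eq_bigr => p _.
  rewrite big_ord_recl /= addn0 subn0; congr (_ + _); first by ring.
  by apply: eq_bigr => q _; rewrite /bump /= add1n subSS addnS.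
have := IH i.+1; rewrite addSnnS => /(_ Hrec) ->.
have -> : \sum_(p < i.+1) \sum_(q < j) b (i.+1 - p)%N * b (j - q)%N * c (p + q).+1%N
    = b i.+1 * U j + W.
  rewrite big_ord_recl /W [_ * U j]mulr_sumr; congr (_ + _).
    by apply: eq_bigr => q _; rewrite subn0 add0n mulrA.
rewrite (rec i _ Hrec) ?(rec j _ Hrec) ?addnS ?ltnS ?leq_addl ?leq_addr //.
by field.
Qed.

Lemma hankel_seq_descent m b c : julia_rec b c (2 * m) -> posdefmx (hankel_seq m.+1 b) ->
  0 < b 1%N /\ posdefmx (hankel_seq m c).
Proof.
move=> Hrec [_ Hpos].
have b1 : 0 < b 1%N.
  have := Hpos (delta_mx 0 0); rewrite trmx_delta -rowE -colE !mxE /=; apply.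
  by apply/eqP => /matrixP/(_ 0 0); rewrite !mxE => /eqP; rewrite oner_eq0.
split=> //; split; first by apply/matrixP => i j; rewrite !mxE addnC.
move=> v v0.
pose A : 'cV[R]_m.+1 := \col_i b i.+1.
pose B : 'M[R]_(m.+1, m) := \matrix_(i, p) if (p < i)%N then b (i - p)%N else 0.
(* [T] is the triangular Toeplitz matrix with entries [b (i - j + 1)], split
   into its first column and the rest. *)
pose T : 'M[R]_(m.+1, 1 + m) := row_mx A B.
pose D : 'M[R]_(1 + m) := block_mx (b 1%N)^-1%:M 0 0 (hankel_seq m c).
have HE : hankel_seq m.+1 b = T *m D *m T^T.
  rewrite /T /D mul_row_block tr_row_mx mul_row_col !mulmx0 addr0 add0r.
  apply/matrixP => i j; rewrite mxE (@hankel_conv b c) ?gt_eqF //; last first.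
    move=> k kij; apply: Hrec; apply: leq_trans kij _.
    by rewrite mul2n -addnn leq_add // -ltnS.
  rewrite [RHS]mxE; congr (_ + _).
    rewrite mxE big_ord1 mul_mx_scalar !mxE; ring.
  rewrite !mxE exchange_big /=.
  rewrite (big_ord_widen m
    (fun q => \sum_(p < i) b (i - p)%N * b (j - q)%N * c (p + q).+1%N)) -1?ltnS //.
  rewrite big_mkcond /=; apply: eq_bigr => q _; rewrite !mxE.
  case: ltnP => qj; last by rewrite mulr0.
  rewrite (big_ord_widen m (fun p => b (i - p)%N * b (j - q)%N * c (p + q).+1%N)) -1?ltnS //.
  rewrite mulr_suml big_mkcond /=; apply: eq_bigr => p _; rewrite !mxE.
  case: ltnP => pi; last by rewrite !mul0r.
  by rewrite mulrAC.
have TU : T \in unitmx.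
  have TE (i : 'I_m.+1) (j : 'I_(1 + m)) : T i j = if (j <= i)%N then b (i - j).+1%N else 0.
    rewrite mxE; case: splitP => k jk; rewrite !mxE jk.
      by rewrite ord1 leq0n subn0.
    by rewrite add1n; case: ltnP => // ki; rewrite subnSK.
  have trigT : is_trig_mx T by apply/is_trig_mxP => i j ij; rewrite TE leqNgt ij.
  rewrite unitmxE det_trig // unitfE.
  by apply/prodf_neq0 => i _; rewrite TE leqnn subnn gt_eqF.
(* A vector with [T^T y = (0, v)] reduces the form of the Hankel matrix at [y]
   to that of the reduced Hankel matrix at [v]. *)
pose u : 'cV[R]_(1 + m) := col_mx 0 v.
pose y : 'cV[R]_m.+1 := invmx (T^T) *m u.
have TTU : T^T \in unitmx by rewrite unitmx_tr.
have yu : T^T *m y = u by rewrite mulKVmx.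
have y0 : y != 0.
  apply: contraNneq v0 => y0; have := congr1 dsubmx yu.
  by rewrite y0 mulmx0 col_mxKd linear0 => <-.
have := Hpos y y0; rewrite HE.
have -> : y^T *m (T *m D *m T^T) *m y = u^T *m D *m u.
  by rewrite -yu [(T^T *m y)^T]trmx_mul trmxK !mulmxA.
rewrite /u /D tr_col_mx mul_row_block mul_row_col trmx0 !mul0mx !mulmx0.
by rewrite !add0r.
Qed.

(** The data obtained after [j] reductions have a positive definite Hankel
matrix of size [k], and the derivatives [t_1, ..., t_j] met on the way are
positive. *)
Lemma iter_data_posdef n (a : int -> R) j k :
  (2 * (j + k) <= n.+1)%N -> posdefmx (hankel_seq (j + k) (fun i => a i%:Z)) ->
  (forall i, (1 <= i <= j)%N -> 0 < t_ n a i) /\ posdefmx (hankel_seq k (iter_data n a j.+1)).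
Proof.
elim: j k => [|j IH] k jn Hp; first by split=> // i; case: i => // i; rewrite ltn0 andbF.
rewrite addSnnS in jn Hp; have [tp Hk] := IH k.+1 jn Hp.
have b1 : iter_data n a j.+1 1%N != 0.
  rewrite gt_eqF //; have := Hk.2 (delta_mx 0 0).
  rewrite trmx_delta -rowE -colE !mxE /=; apply.
  by apply/eqP => /matrixP/(_ 0 0); rewrite !mxE => /eqP; rewrite oner_eq0.
have [|tj Hk'] := @hankel_seq_descent k (iter_data n a j.+1) (iter_data n a j.+2) _ Hk.
  move=> i ik; apply: (reduce_data_rec (N := n.+1 - 2 * j.+1) b1).
  apply: leq_trans ik _; lia.
split=> // i /andP[i1]; rewrite leq_eqVlt => /orP[/eqP -> //|ij].
by apply: tp; rewrite i1 -ltnS.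
Qed.

End Hankel.

(** * The polynomial matrices *)

Section Matrices.
Variable R : realType.
Implicit Types (M N : 'M[{poly R}]_2) (p q : {poly R}) (n m k : nat) (a : int -> R) (x : R).

Lemma mulmx2E M N i j : (M * N) i j = M i 0 * N 0 j + M i 1 * N 1 j.
Proof.
rewrite mxE !big_ord_recl big_ord0 addr0.
by congr (M _ _ * N _ _ + M _ _ * N _ _); apply: val_inj.
Qed.

Lemma A_prod0 n x a : A_prod n x a 0 = 1.
Proof. by rewrite /A_prod big_nil. Qed.

Lemma A_prodS n x a k : A_prod n x a k.+1 = A_prod n x a k * A_ n x a k.+1.
Proof. by rewrite /A_prod big_nat_recr. Qed.

Lemma size_A n x a k i j : (size (A_ n x a k i j) <= 2)%N.
Proof.
have w2 (c : R) : (size (c *: ('X - x%:P)) <= 2)%N.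
  by rewrite (leq_trans (size_scale_leq _ _)) // size_XsubC.
rewrite mxE; case: ifP => _; case: ifP => _; rewrite ?w2 //.
  rewrite (leq_trans (size_polyD _ _)) // geq_max !size_polyN w2.
  by rewrite (leq_trans (size_polyC_leq1 _)).
by rewrite size_polyN size_poly1.
Qed.

Lemma size_A_prod n x a m i j : (size (A_prod n x a m i j) <= m.+1)%N.
Proof.
elim: m i j => [|m IH] i j.
  by rewrite A_prod0 mxE; case: eqP; rewrite ?size_poly1 ?size_poly0.
rewrite A_prodS mulmx2E (leq_trans (size_polyD _ _)) // geq_max.
have le2 p q : (size p <= m.+1)%N -> (size q <= 2)%N -> (size (p * q)%R <= m.+2)%N.
  move=> hp hq; apply: leq_trans (size_polyMleq _ _) _; lia.
by rewrite !le2 ?IH ?size_A.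
Qed.

Lemma det2M M N :
  (M * N) 0 0 * (M * N) 1 1 - (M * N) 0 1 * (M * N) 1 0 =
  (M 0 0 * M 1 1 - M 0 1 * M 1 0) * (N 0 0 * N 1 1 - N 0 1 * N 1 0).
Proof. by rewrite !mulmx2E; ring. Qed.

Lemma det_A_prod n x a m : (forall k, (1 <= k <= m)%N -> 0 < t_ n a k) ->
  exists K : R, 0 < K /\
  A_prod n x a m 0 0 * A_prod n x a m 1 1 - A_prod n x a m 0 1 * A_prod n x a m 1 0
  = K *: ('X - x%:P) ^+ (2 * m).
Proof.
elim: m => [|m IH] tp.
  by exists 1; split=> //; rewrite A_prod0 !mxE /= scale1r expr0; ring.
have [|K [K0 KE]] := IH; first by move=> k /andP[k1 km]; rewrite tp // k1 ltnW.
exists (K * t_ n a m.+1 ^+ 2); split.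
  by rewrite mulr_gt0 // exprn_gt0 // tp //= ltnSn.
rewrite A_prodS det2M KE !mxE /= mulnS exprD -!mul_polyC !rmorphM /=.
ring.
Qed.

Lemma evalCD p q z : evalC (p + q) z = evalC p z + evalC q z.
Proof. by rewrite /evalC rmorphD /= hornerD. Qed.
Lemma evalCM p q z : evalC (p * q) z = evalC p z * evalC q z.
Proof. by rewrite /evalC rmorphM /= hornerM. Qed.
Lemma evalCN p z : evalC (- p) z = - evalC p z.
Proof. by rewrite /evalC rmorphN /= hornerN. Qed.
Lemma evalCC (c : R) z : evalC c%:P z = c%:C%C.
Proof. by rewrite /evalC map_polyC hornerC. Qed.
Lemma evalC1 z : evalC (1 : {poly R}) z = 1.
Proof. by rewrite -[1]/(1%:P) evalCC. Qed.
Lemma evalC0 z : evalC (0 : {poly R}) z = 0.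
Proof. by rewrite -[0]/(0%:P) evalCC. Qed.
Lemma evalCXsub x z : evalC ('X - x%:P) z = z - x%:C%C.
Proof. by rewrite evalCD evalCN evalCC /evalC map_polyX hornerX. Qed.

(** Row [i] of the column [M(z) (u, 1)^T]: the numerator and the denominator
of the linear fractional map of [M] at [u]. *)
Definition mobius_row M (i : 'I_2) (z u : R[i]) := evalC (M i 0) z * u + evalC (M i 1) z.

Lemma mobius_rowM M N i z u :
  mobius_row (M * N) i z u =
  evalC (M i 0) z * mobius_row N 0 z u + evalC (M i 1) z * mobius_row N 1 z u.
Proof. by rewrite /mobius_row !mulmx2E !evalCD !evalCM; ring. Qed.

Lemma mobius_row_A0 n x a k z u : mobius_row (A_ n x a k) 0 z u =
  (s_ n a k)%:C%C * ((t_ n a k)%:C%C * (z - x%:C%C) * u - 1) - (t_ n a k)%:C%C * (z - x%:C%C).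
Proof.
rewrite /mobius_row !mxE /= -!mul_polyC !(evalCXsub, evalCM, evalCN, evalCD, evalCC).
rewrite rmorphM /=; ring.
Qed.

Lemma mobius_row_A1 n x a k z u : mobius_row (A_ n x a k) 1 z u =
  (t_ n a k)%:C%C * (z - x%:C%C) * u - 1.
Proof. by rewrite /mobius_row !mxE /= -!mul_polyC !(evalCXsub, evalCM, evalCN, evalC1, evalCC). Qed.

End Matrices.

(** * Stages of the reduction *)

Section Solutions.
Variables (R : realType) (n : nat) (x : R) (a : int -> R).
Local Notation C := R[i].
Local Notation K := (R[i] : numFieldType).
Implicit Types (f g F G h H : C -> C) (z : C).
Local Notation Im := complex.Im.

(** Solutions of the problem that remains after [j] reductions: Pick functions
analytic at [x] whose Taylor coefficients are the entries of [a(j+1)] that are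
defined, namely those of index [i <= n - 2 j]. *)
Definition stage j f := pick_fun f /\ exists2 c, boundary_taylor f x c &
  forall i, (i + 2 * j <= n)%N -> c i = (iter_data n a j.+1 i)%:C%C.

Lemma pick_ext f g : (forall z, 0 < Im z -> f z = g z) -> pick_fun f -> pick_fun g.
Proof.
move=> fg [fT fP]; split=> z z0; last by rewrite -fg // fP.
have [c Hc] := fT z z0; exists c; apply: taylor_ext Hc.
exists (Im z) => // u uz; rewrite fg //.
by have := le_lt_trans (Im_le_nrm _) uz; rewrite ImB ltr_norml => /andP[+ _]; lra.
Qed.

Lemma stage_ext j f g : (forall z, 0 < Im z -> f z = g z) -> stage j f -> stage j g.
Proof.
move=> fg [fp [c [F [F1 F2 [e e0 Ff]]] cE]]; split; first exact: pick_ext fp.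
exists c => //; exists F; split=> //; exists e => // z ze z0.
by rewrite Ff // fg.
Qed.

(** The recursion determines the reduced coefficients from the original ones.
*)
Lemma julia_rec_unique (b b' : nat -> R) (c c' : nat -> C) N :
  b 1%N != 0 -> julia_rec b b' N ->
  c 1%N = (b 1%N)%:C%C ->
  (forall k, c k.+2 = (b 1%N)%:C%C * \sum_(i < k.+1) c i.+1 * c' (k - i)%N) ->
  (forall k, (k < N.+2)%N -> c k = (b k)%:C%C) ->
  forall k, (k < N)%N -> c' k = (b' k)%:C%C.
Proof.
move=> b1 Hb c1 Hc cb; elim/ltn_ind => k IH kN.
have b1C := real_neq0 b1.
have := Hc k; rewrite cb // Hb // rmorphM rmorph_sum /= => /(mulfI b1C)/esym.
rewrite !big_ord_recl /= !subn0 c1 rmorphM /=.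
rewrite (eq_bigr (fun i : 'I_k => (b (bump 0 i).+1 * b' (k - bump 0 i)%N)%:C%C)).
  by move=> /addIr /(mulfI b1C).
move=> i _; rewrite /bump /= add1n rmorphM /= cb; last first.
  by rewrite !ltnS (leq_trans (ltn_ord i)) // ltnW // ltnW.
rewrite [X in _ * X = _]IH //; first by rewrite subnSK ?leq_subr //.
by rewrite (leq_ltn_trans (leq_subr _ _)).
Qed.

(** The recursion determines the original coefficients from the reduced ones
and the first two. *)
Lemma julia_rec_transfer (b b' : nat -> R) (c c' : nat -> C) N :
  julia_rec b b' N ->
  c 0%N = (b 0%N)%:C%C -> c 1%N = (b 1%N)%:C%C ->
  (forall k, c k.+2 = (b 1%N)%:C%C * \sum_(i < k.+1) c i.+1 * c' (k - i)%N) ->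
  (forall k, (k < N)%N -> c' k = (b' k)%:C%C) ->
  forall k, (k < N.+2)%N -> c k = (b k)%:C%C.
Proof.
move=> Hb c0 c1 Hc cb; elim/ltn_ind => -[_ _|[_ _|k IH kN]] //.
rewrite Hc Hb // rmorphM rmorph_sum /=; congr (_ * _); apply: eq_bigr => i _.
have ik : (i <= k)%N by rewrite -ltnS.
rewrite rmorphM /= IH //; last by clear -ik kN; lia.
by rewrite cb // (leq_ltn_trans (leq_subr _ _)).
Qed.

Lemma stage_reduce j f : (2 * j.+1 <= n.+1)%N -> 0 < t_ n a j.+1 -> stage j f ->
  exists2 h, stage j.+1 h &
    forall z, 0 < Im z -> f z = augment (s_ n a j.+1) (t_ n a j.+1) x h z.
Proof.
move=> jn t0 [fp [c fb cE]].
have c0 : c 0%N = (s_ n a j.+1)%:C%C by apply: cE; lia.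
have c1 : c 1%N = (t_ n a j.+1)%:C%C by apply: cE; lia.
have [h [c' [hp hb hf hc]]] := julia_reduce fp fb c0 c1 t0.
exists h => //; split=> //; exists c' => // i ij.
apply: (@julia_rec_unique (iter_data n a j.+1) _ c c' (n.+1 - 2 * j.+1)) => //.
- by rewrite gt_eqF.
- by apply: reduce_data_rec; rewrite gt_eqF.
- move=> k kN; apply: cE; lia.
- lia.
Qed.

Lemma stage_augment j h : (2 * j.+1 <= n.+1)%N -> 0 < t_ n a j.+1 -> stage j.+1 h ->
  stage j (augment (s_ n a j.+1) (t_ n a j.+1) x h).
Proof.
move=> jn t0 [hp [c' hb cE]]; split; first exact: pick_augment.
have [c [cb c0 c1 hc]] := boundary_augment (s_ n a j.+1) t0 hb.
exists c => // i ij.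
apply: (@julia_rec_transfer (iter_data n a j.+1) (iter_data n a j.+2) c c' (n.+1 - 2 * j.+1)) => //.
- by apply: reduce_data_rec; rewrite gt_eqF.
- move=> k kN; apply: cE; lia.
- lia.
Qed.

(** Solutions of the problem without pole are the images of the solutions at
stage [j] under the linear fractional map of [A_1 ... A_j], whose denominator
does not vanish. *)
Lemma stage_chain j : (2 * j <= n.+1)%N ->
  (forall i, (1 <= i <= j)%N -> 0 < t_ n a i) ->
  (forall h, stage j h -> forall z, 0 < Im z -> mobius_row (A_prod n x a j) 1 z (h z) != 0) /\
  (forall f, stage 0 f <-> exists h, stage j h /\ forall z, 0 < Im z ->
    f z = mobius_row (A_prod n x a j) 0 z (h z) / mobius_row (A_prod n x a j) 1 z (h z)).
Proof.
elim: j => [|j IH] jn tp.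
  have m0 z u : mobius_row (A_prod n x a 0) 0 z u = u.
    by rewrite A_prod0 /mobius_row !mxE /= evalC1 evalC0 mul1r addr0.
  have m1 z u : mobius_row (A_prod n x a 0) 1 z u = 1.
    by rewrite A_prod0 /mobius_row !mxE /= evalC1 evalC0 mul0r add0r.
  split=> [h _ z _|f]; first by rewrite m1 oner_neq0.
  split=> [fs|[h [hs fh]]]; first by exists f; split=> // z _; rewrite m0 m1 divr1.
  by apply: stage_ext hs => z z0; rewrite fh // m0 m1 divr1.
have [|i /andP[i1 ij]|nz chain] := IH; first by lia.
  by rewrite tp // i1 ltnW.
have t0 : 0 < t_ n a j.+1 by rewrite tp //= ltnSn.
set s := s_ n a j.+1; set t := t_ n a j.+1 in t0 *.
have mobE h i z : stage j.+1 h -> 0 < Im z ->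
    mobius_row (A_prod n x a j.+1) i z (h z) =
    mobius_row (A_ n x a j.+1) 1 z (h z) * mobius_row (A_prod n x a j) i z (augment s t x h z).
  move=> hs z0; rewrite A_prodS mobius_rowM mobius_row_A0 mobius_row_A1 -/s -/t /mobius_row /augment.
  have d0 : 1 - t%:C%C * (z - x%:C%C) * h z != 0 by apply: augment_denom_neq0 => //; case: hs.
  by field.
have Anz h z : stage j.+1 h -> 0 < Im z -> mobius_row (A_ n x a j.+1) 1 z (h z) != 0.
  move=> hs z0; rewrite mobius_row_A1 -/t -opprB oppr_eq0.
  by apply: augment_denom_neq0 => //; case: hs.
have ratio h z : stage j.+1 h -> 0 < Im z ->
    mobius_row (A_prod n x a j.+1) 0 z (h z) / mobius_row (A_prod n x a j.+1) 1 z (h z) =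
    mobius_row (A_prod n x a j) 0 z (augment s t x h z) /
    mobius_row (A_prod n x a j) 1 z (augment s t x h z).
  move=> hs z0; rewrite !mobE //; by rewrite -mulf_div divff ?Anz // mul1r.
split=> [h hs z z0|f].
  by rewrite mobE // mulf_neq0 ?Anz // nz //; exact: stage_augment.
rewrite chain; split=> [[h [hs fh]]|[h [hs fh]]].
  have [h' hs' hh'] := stage_reduce jn t0 hs.
  by exists h'; split=> // z z0; rewrite fh // ratio // hh'.
exists (augment s t x h); split; first exact: stage_augment.
by move=> z z0; rewrite fh // ratio.
Qed.

Lemma pick_classP f : pick_class f <-> pick_fun f.
Proof.
split=> [fp|[fT fP] z z0].
  by split=> z z0; have [/analytic_atP ? ?] := fp z z0.
by split; [apply/analytic_atP; exact: fT|exact: fP].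
Qed.

(** Removing the pole. *)
Lemma bCFP_stage0 f : a (-1) <= 0 ->
  bCFP_solution n x (fun k => (a k)%:C%C) f <->
  stage 0 (fun z => f z - (a (-1))%:C%C / (z - x%:C%C)).
Proof.
move=> am; rewrite /bCFP_solution pick_classP.
have pT z (r : C) : 0 < Im z -> exists c, taylor (fun z => r / (z - x%:C%C)) z c.
  by move=> z0; apply: taylor_pole; rewrite -subr_eq0 pick_neq.
split=> [[fp [L [Lf La]]]|[[fT fP] [c [F [FT FA Ff]] cE]]].
  have [F [FT FA [e e0 Ff]]] := laurent_pick fp.2 Lf.
  have Lm : L (-1) = (a (-1))%:C%C by apply: La.
  have fF z : nrm (z - x%:C%C) < e -> 0 < Im z -> F z = f z - (a (-1))%:C%C / (z - x%:C%C).
    by move=> ze z0; rewrite Ff // Lm addrC addrA addNr add0r.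
  split; first split.
  - move=> z z0; have [c Hc] := fp.1 z z0.
    have [d Hd] := pT z (- (a (-1))%:C%C) z0.
    eexists; apply: taylor_ext (taylorD Hc Hd); exists 1 => // u _.
    by rewrite mulNr.
  - have aN : 0 <= - a (-1) by rewrite oppr_ge0.
    have aE z : f z + (- a (-1))%:C%C / (z - x%:C%C) = f z - (a (-1))%:C%C / (z - x%:C%C).
      by rewrite rmorphN /= mulNr.
    move=> z z0; rewrite -aE.
    apply: (@pole_removal R f x (- a (-1)) (F x%:C%C) fp.1 fp.2 aN) z0 => h h0.
    have [d d0 Hd] := taylor_cont FT h0.
    exists (Num.min d e); first by rewrite lt_min d0.
    by move=> u u0; rewrite lt_min => /andP[ud ue]; rewrite aE -fF // Hd.
  exists (fun k => L k%:Z); first by exists F; split=> //; exists e.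
  by move=> i; rewrite muln0 addn0 => ij; apply: La; rewrite lez_nat ij andbT.
split.
  split=> z z0.
    have [b Hb] := fT z z0; have [d Hd] := pT z (a (-1))%:C%C z0.
    by eexists; apply: taylor_ext (taylorD Hb Hd); exists 1 => // u _; rewrite subrK.
  have := fP z z0; rewrite ImB Im_pole opprK => h.
  have : 0 <= - (a (-1) * Im z / nrm (z - x%:C%C) ^+ 2).
    by rewrite -!mulNr divr_ge0 ?sqr_ge0 // mulr_ge0 ?oppr_ge0 // ltW.
  lra.
eexists; split.
  apply: (has_laurent_of_taylor (r := (a (-1))%:C%C) FT FA); case: Ff => e e0 Ff.
  by exists e => // z ze z0; rewrite Ff //= addrC subrK.
move=> [k|[|k]] //= kn; apply: cE.
by rewrite muln0 addn0.
Qed.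

(** At stage [m] there is no condition left when [n] is odd, and the single
condition [h x = s_(m+1)] when [n] is even. *)
Lemma admissible_stage m h : (0 < m)%N -> m = n.+1./2 -> 0 < t_ n a m ->
  pick_analytic_at x h (fun hx => ~~ odd n -> hx = (s_last n a m)%:C%C) <->
  stage m h.
Proof.
case: m => // m _ mn tm; rewrite /pick_analytic_at pick_classP.
have nE := odd_double_half n.+1; rewrite -mn /= in nE.
have sE : ~~ odd n -> s_last n a m.+1 = iter_data n a m.+2 0%N.
  move=> on; rewrite on /= in nE.
  have : julia_rec (iter_data n a m.+1) (iter_data n a m.+2) 1.
    have -> : 1%N = (n.+1 - 2 * m.+1)%N by lia.
    by apply: reduce_data_rec; rewrite gt_eqF.
  move=> /(_ 0%N isT); rewrite big_ord_recl big_ord0 addr0 subn0 => E.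
  by rewrite /s_last E; field; rewrite gt_eqF.
split=> [[hp [H [[/near_nrm Hh /near_nrm HA] Hx]]]|[hp [c [H [HT HA Hh]] cE]]]; split=> //.
  have [e e0 HA'] := HA.
  have /analytic_atP [c HT] : @analytic_at R[i] H x%:C%C.
    by apply: HA'; rewrite subrr nrm0.
  exists c.
    exists H; split=> //.
    by exists e => // z /HA' /analytic_atP.
  move=> i im; have on : ~~ odd n by lia.
  have -> : i = 0%N by lia.
  by rewrite -(taylor_value HT) Hx // sE.
exists H; split; first split.
- by case: Hh => e e0 Hh; apply/near_nrm; exists e.
- by case: HA => e e0 HA; apply/near_nrm; exists e => // z ze; apply/analytic_atP; exact: HA.
move=> on; rewrite (taylor_value HT) cE ?sE //.
by rewrite on /= in nE; lia.
Qed.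

End Solutions.

Theorem corollary8p6 (R : realType) (n : nat) (x : R) (a : int -> R) :
  (1 <= n)%N -> a (-1) <= 0 -> a 1 != 0 ->
  let m := n.+1./2 in
  posdefmx (hankel m a) ->
  let M := A_prod n x a m in
  let A := M 0 0 in
  let B := M 0 1 in
  let C := M 1 0 in
  let D := M 1 1 in
  let admissible (h : R[i] -> R[i]) :=
    pick_analytic_at x h
      (fun hx => ~~ odd n -> hx = (s_last n a m)%:C%C) in
  [/\ [/\ (size A <= m.+1)%N, (size B <= m.+1)%N,
          (size C <= m.+1)%N & (size D <= m.+1)%N],
      (exists K : R, 0 < K /\ A * D - B * C = K *: ('X - x%:P) ^+ (2 * m)),
      (* the linear fractional expression is defined on the half-plane *)
      (forall h, admissible h ->
         forall z, upper_half_plane z -> evalC C z * h z + evalC D z != 0)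
    & (* the solutions are exactly the functions of the given form *)
      forall f : R[i] -> R[i],
        bCFP_solution n x (fun k => (a k)%:C%C) f <->
        exists h, admissible h /\
          forall z, upper_half_plane z ->
            f z = (a (-1))%:C%C / (z - x%:C%C)
                  + (evalC A z * h z + evalC B z)
                    / (evalC C z * h z + evalC D z)].
Proof.
move=> n1 am a1 m Hpos M A B C D admissible.
have nm : (2 * m <= n.+1)%N by rewrite mul2n -[leqRHS]odd_double_half leq_addl.
have m0 : (0 < m)%N by rewrite /m; case: (n) n1.
have tp : forall i, (1 <= i <= m)%N -> 0 < t_ n a i.
  have [] // := @iter_data_posdef R n a m 0; first by rewrite addn0.
  rewrite addn0 (_ : hankel_seq m _ = hankel m a) //.
  by apply/matrixP => i j; rewrite !mxE addn1.
have [nz chain] := stage_chain x nm tp.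
have adm h : admissible h <-> stage n x a m h.
  by apply: admissible_stage => //; apply: tp; rewrite m0 leqnn.
split.
- by split; exact: size_A_prod.
- exact: det_A_prod.
- by move=> h /adm hs z z0; exact: nz.
move=> f; rewrite bCFP_stage0 // chain; split=> -[h [hs fh]]; exists h; split; try exact/adm.
  move=> z z0; rewrite addrC -[in RHS]/(mobius_row M 0 z (h z)) -[in RHS]/(mobius_row M 1 z (h z)).
  by rewrite -fh // subrK.
by move=> z z0; rewrite fh // addrC addKr.
Qed.
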